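(* Let $k\in\mathbb{N}$ and let $H:\mathbb{R}_{\ge 0}^k\to\mathbb{R}$ be a function such that $$\int_{B(0,1)}\Big|H\big(|c_1(\alpha)|,\dots,|c_k(\alpha)|\big)\Big|^2\,d\mu<\infty.$$ Let $(a_n)_{n=1}^\infty$ be an $L^2$-good universal sequence of natural numbers such that $(a_n\theta)_{n=1}^\infty$ is uniformly distributed modulo $1$ for every irrational number $\theta$. Then $$\lim_{n\to\infty}\frac1n\sum_{j=1}^nH\big(|c_{a_j}(\alpha)|,\dots,|c_{a_j+k-1}(\alpha)|\big)=\sum_{(i_1,\dots,i_k)\in\mathbb{N}^k}H\left(p^{\frac{i_1}{e}},\dots,p^{\frac{i_k}{e}}\right)\frac{(p^f-1)^k}{p^{f(i_1+\cdots+i_k)}}$$ for $\mu$-almost every $\alpha\in B(0,1)$.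
   Context: $\mathbb{N}$ denotes the positive integers. Let $p$ be a prime and let $K$ be a finite extension of $\mathbb{Q}_p$ of degree $m$, with ramification index $e$ and residue degree $f$ (so $m=ef$). Let $|\cdot|$ be the unique extension to $K$ of the $p$-adic absolute value with $|p|=p^{-1}$. Let $L\subseteq K$ be the unramified subextension of degree $f$ over $\mathbb{Q}_p$, write $L=\mathbb{Q}_p(\gamma)$ with $\gamma$ a primitive $(p^f-1)$-th root of unity, and fix $\beta\in K$ with $K=L(\beta)$ and $|\beta|=p^{1/e}$. For $b=\sum_{j\ge n_0}a_jp^j\in\mathbb{Q}_p$ with digits $a_j\in\{0,1,\dots,p-1\}$ put $\lfloor b\rfloor_p=\sum_{n_0\le j\le 0}a_jp^j$ (which is $0$ if $|b|<1$). Every $\alpha\in K$ is uniquely $\alpha=\sum_{i=0}^{e-1}\sum_{j=0}^{f-1}b_{i,j}\gamma^j\beta^i$ with $b_{i,j}\in\mathbb{Q}_p$, and $\lfloor\alpha\rfloor=\sum_{i=0}^{e-1}\sum_{j=0}^{f-1}\lfloor b_{i,j}\rfloor_p\gamma^j\beta^i$. Let $B(0,1)=\{x\in K:|x|<1\}$, and let $\mu$ be the restriction to $B(0,1)$ (with its Borel $\sigma$-algebra) of the Haar measure of the additive group $K$, normalized by $\mu(B(0,1))=1$. The continued fraction map $T:B(0,1)\to B(0,1)$ is $T(\alpha)=\frac1\alpha-\left\lfloor\frac1\alpha\right\rfloor$ for $\alpha\ne 0$ and $T(0)=0$. The $n$-th partial quotient of $\alpha\in B(0,1)$ is $c_n(\alpha)=\lfloor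 1/T^{n-1}(\alpha)\rfloor$ for $n\ge 1$, defined when $T^{n-1}(\alpha)\neq 0$ (so all $c_n(\alpha)$ are defined for $\mu$-almost every $\alpha$). A strictly increasing sequence of positive integers $(a_n)_{n\ge1}$ is $L^2$-good universal if for each measure-preserving dynamical system $(X,\mathcal{C},\nu,S)$ on a probability space and each $g\in L^2(X,\mathcal{C},\nu)$ the limit $\lim_{n\to\infty}\frac1n\sum_{j=1}^n g(S^{a_j-1}x)$ exists for $\nu$-almost every $x$. A real sequence $(x_n)_{n\ge1}$ is uniformly distributed modulo $1$ if for each interval $I\subseteq[0,1)$, $\lim_{n\to\infty}\frac1n\#\{1\le j\le n:\{x_j\}\in I\}$ equals the length of $I$, where $\{x_j\}$ is the fractional part. *)

(* Defs.v *)
From HB Require Import structures.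
From mathcomp Require Import all_boot all_order all_algebra all_field.
From mathcomp Require Import all_classical all_reals all_analysis.

Set Implicit Arguments.
Unset Strict Implicit.
Unset Printing Implicit Defensive.

Import Order.TTheory GRing.Theory Num.Theory.
Import numFieldNormedType.Exports.

Local Open Scope classical_set_scope.
Local Open Scope ring_scope.

Record absolute_value (R : realType) (F : fieldType) := AbsoluteValue {
  absv :> F -> R;
  absv_ge0 : forall x, 0 <= absv x;
  absv_eq0 : forall x, absv x = 0 <-> x = 0;
  absvM : forall x y, absv (x * y) = absv x * absv y;
  absv_triangle : forall x y, absv (x + y) <= absv x + absv y }.

Definition absv_nng (R : realType) (F : fieldType) (v : absolute_value R F)
  (x : F) : {nonneg R} := NngNum (absv_ge0 v x).

(* Alias of F carrying the metric topology of v. *)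
Definition valued (R : realType) (F : fieldType) (v : absolute_value R F)
  : Type := F.

Section valued_metric.
Variables (R : realType) (F : fieldType) (v : absolute_value R F).

HB.instance Definition _ := Choice.on (valued v).
HB.instance Definition _ := isPointed.Build (valued v) (0 : F).

Definition vdist (x y : valued v) : R := v ((x : F) - (y : F)).

Let vdistxx x : vdist x x = 0.
Proof. by rewrite /vdist subrr; apply/absv_eq0. Qed.

Let vdist_eq0 x y : vdist x y = 0 -> x = y.
Proof. by move/absv_eq0/eqP; rewrite subr_eq0 => /eqP. Qed.

Let absvN1 : v (-1) = 1.
Proof.
have v1 : v 1 = 1.
  have : v 1 * v 1 = v 1 * 1 by rewrite -absvM !mulr1.
  apply: mulfI; apply/eqP => /absv_eq0/eqP; by rewrite oner_eq0.
have /eqP : v (-1) ^+ 2 = 1 by rewrite expr2 -absvM mulrNN mulr1.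
rewrite sqrf_eq1 => /orP[/eqP//|/eqP vN1].
by have := absv_ge0 v (-1); rewrite vN1 oppr_ge0 leNgt ltr01.
Qed.

Let vdist_sym x y : vdist x y = vdist y x.
Proof. by rewrite /vdist -opprB -mulN1r absvM absvN1 mul1r. Qed.

Let vdist_triangle y x z : vdist x z <= vdist x y + vdist y z.
Proof. by apply: le_trans (absv_triangle _ _ _); rewrite addrA subrK. Qed.

HB.instance Definition _ := isMetric.Build R (valued v)
  vdistxx vdist_eq0 vdist_sym vdist_triangle.

End valued_metric.

(* The p-adic absolute value of a rational number. *)
Definition padic_abs (R : realType) (p : nat) (q : rat) : R :=
  if q == 0 then 0
  else p%:R ^ ((logn p `|denq q|%N)%:Z - (logn p `|numq q|%N)%:Z).

(* (Qp, vp) is the field of p-adic numbers: the completion of the rationals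
   for the p-adic absolute value. *)
Definition padic_completion (R : realType) (p : nat) (Qp : fieldType)
    (vp : absolute_value R Qp) : Prop :=
  [/\ forall q : rat, vp (ratr q) = padic_abs R p q,
      dense (range (ratr : rat -> valued vp)) &
      forall u : nat -> valued vp, cauchy (u @ \oo) -> cvg (u @ \oo)].

Section local_field.
Variables (R : realType) (Qp : fieldType) (K : fieldExtType Qp).
Variable v : absolute_value R K.

(* e is the index of |Qp^*| in |E^*|: t lists representatives of the cosets. *)
Definition ramification_index (E : {subfield K}) (e : nat) : Prop :=
  exists2 t : 'I_e -> K, (forall i, t i \in E /\ t i != 0) &
    forall x, x \in E -> x != 0 ->
      exists! i, exists2 c : Qp, c != 0 & v x = v c%:A * v (t i).

(* The classes of u_1, ..., u_f modulo the maximal ideal { |x| < 1 } form a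
   basis of the residue field of E over the residue field of Qp. *)
Definition residue_degree (E : {subfield K}) (f : nat) : Prop :=
  exists u : 'I_f -> K,
  [/\ forall i, u i \in E /\ v (u i) <= 1,
      forall x, x \in E -> v x <= 1 -> exists2 c : 'I_f -> Qp,
        forall i, v (c i)%:A <= 1 & v (x - \sum_i c i *: u i) < 1 &
      forall c : 'I_f -> Qp, (forall i, v (c i)%:A <= 1) ->
        v (\sum_i c i *: u i) < 1 -> forall i, v (c i)%:A < 1].

Definition unramified (E : {subfield K}) : Prop := ramification_index E 1.

Definition borel : Type := g_sigma_algebraType (@open (valued v)).
HB.instance Definition _ := Measurable.on borel.

Definition unit_ball : set borel := [set x | v x < 1].

(* Regularity is automatic on the second countable locally compact group K. *)
Definition haar (mu : {measure set borel -> \bar R}) : Prop :=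
  [/\ forall (x : K) (A : set borel), measurable A ->
        mu [set x + (y : K) | y in A] = mu A,
      forall A : set (valued v), compact A -> (mu A < +oo)%E &
      forall A : set (valued v), open A -> A !=set0 -> (0 < mu A)%E].

End local_field.

Arguments unit_ball {R Qp K} v.
Arguments haar {R Qp K v} mu.
Arguments ramification_index {R Qp K} v E e.
Arguments residue_degree {R Qp K} v E f.
Arguments unramified {R Qp K} v E.
Arguments borel {R Qp K} v.

Section continued_fraction.
Variables (R : realType) (p : nat).
Variables (Qp : fieldType) (vp : absolute_value R Qp).

(* b = \sum_(j >= n0) d_j p^j with digits d_j in {0, ..., p - 1} *)
Definition padic_expansion (n0 : int) (d : int -> nat) (b : Qp) : Prop :=
  (forall j, (d j < p)%N) /\
  (fun n : nat => (\sum_(i < n) (d (n0 + i%:Z))%:R * p%:R ^ (n0 + i%:Z))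
     : valued vp) @ \oo --> (b : valued vp).

Definition padic_floor (b : Qp) : Qp :=
  xget 0 [set y | exists (n0 : int) (d : int -> nat), padic_expansion n0 d b /\
    y = \sum_(i < `|n0|%N.+1 | n0 + i%:Z <= 0)
          (d (n0 + i%:Z))%:R * p%:R ^ (n0 + i%:Z)].

Variables (K : fieldExtType Qp) (e f : nat) (gamma beta : K).

Definition basis_comb (b : 'I_e -> 'I_f -> Qp) : K :=
  \sum_(i < e) \sum_(j < f) b i j *: (gamma ^+ j * beta ^+ i).

Definition cf_floor (alpha : K) : K :=
  xget 0 [set y | exists2 b : 'I_e -> 'I_f -> Qp, alpha = basis_comb b &
    y = basis_comb (fun i j => padic_floor (b i j))].

Definition cf_map (alpha : K) : K :=
  if alpha == 0 then 0 else alpha^-1 - cf_floor alpha^-1.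

(* For n >= 1; the value is cf_floor 0 = 0 when T^(n-1)(alpha) = 0, which is a
   null event. *)
Definition partial_quotient (n : nat) (alpha : K) : K :=
  cf_floor (iter n.-1 cf_map alpha)^-1.

End continued_fraction.

(* Sequences (a_n)_{n >= 1} are functions on nat whose value at 0 is ignored. *)

Definition strictly_increasing_pos (a : nat -> nat) : Prop :=
  (forall n, (1 <= n)%N -> (0 < a n)%N) /\
  (forall m n, (1 <= m)%N -> (m < n)%N -> (a m < a n)%N).

Definition measure_preserving (R : realType) (d : measure_display)
    (X : measurableType d) (nu : probability X R) (S : X -> X) : Prop :=
  measurable_fun setT S /\
  (forall A : set X, measurable A -> nu (S @^-1` A) = nu A).

Definition L2_good_universal (R : realType) (a : nat -> nat) : Prop :=
  strictly_increasing_pos a /\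
  forall (d : measure_display) (X : measurableType d) (nu : probability X R)
    (S : X -> X), measure_preserving nu S ->
  forall g : X -> R, g \in Lfun nu 2%:E ->
    {ae nu, forall x,
      cvg ((fun n : nat =>
        n%:R^-1 * \sum_(1 <= j < n.+1) g (iter (a j - 1)%N S x)) @ \oo)}.

Definition frac_part (R : realType) (x : R) : R := x - (Num.floor x)%:~R.

Definition uniformly_distributed_mod1 (R : realType) (x : nat -> R) : Prop :=
  forall I : interval R, [set` I] `<=` `[0, 1[ ->
    (fun n : nat =>
      n%:R^-1 * (\sum_(1 <= j < n.+1) (frac_part (x j) \in I))%N%:R : R) @ \oo
    --> fine (lebesgue_measure [set` I]).

(* The value of an absolutely convergent sum over a countable set. *)
Definition sum_over (R : realType) (T : choiceType) (D : set T) (h : T -> R)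
  : R :=
  fine (\esum_(x in D) ((EFin \o h)^\+ x) - \esum_(x in D) ((EFin \o h)^\- x))%E.

(* Main.v *)
(** Since the integral part is a section of K -> K/B(0,1), inversion shows that the
    points whose first partial quotients are prescribed form a ball, of measure
    q^(-2(i_1+...+i_n)) with q = p^f when the partial quotients have norms
    p^(i_1/e), ..., p^(i_n/e); and there are (q-1)q^i partial quotients of norm
    p^(i/e).  So under mu the exponents of the norms are independent, with law
    (q-1)q^(-i).  The averages of a square-integrable function of k consecutive
    exponents along a strictly increasing sequence therefore have variance O(1/n),
    as terms at distance at least k are uncorrelated.  Their almost sure limit,
    which exists because (a_n) is good universal, is the mean by Fatou's lemma. *)
Require Import Defs.
From HB Require Import structures.
From mathcomp Require Import all_boot all_order all_algebra all_field.
From mathcomp Require Import all_classical all_reals all_analysis.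
From mathcomp Require Import measurable_realfun.
From mathcomp Require Import zify ring lra.

Set Implicit Arguments.
Unset Strict Implicit.
Unset Printing Implicit Defensive.

Import Order.TTheory GRing.Theory Num.Theory.
Import numFieldNormedType.Exports.

Local Open Scope classical_set_scope.
Local Open Scope ring_scope.

(** * Absolute values *)

(** Good universality is applied to the shift on sequences of natural numbers under the law of the
    norm exponents, rather than to the continued fraction map on the ball. That law is a product on
    prefix sets, which form a countable pi-system, so invariance and independence both follow from
    uniqueness of measures. A set of points with prescribed norms is carried as a finite disjoint
    union of balls of one common radius. This form is stable under preimage by the continued
    fraction map on a sphere, so that measures reduce to counting centres. The ball geometry is
    developed from four facts: [v] is ultrametric, its nonzero values are integral powers of
    [v beta], there is a finite system of residue representatives, and the integral part depends
    only on the class modulo the open unit ball. All are read off the basis gamma^j beta^i: counting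
    residues makes the powers of [gamma] independent modulo the maximal ideal, while the values of
    the powers beta^i, i < e, lie in distinct classes modulo the values of [Qp]. Hence every term of
    a combination is bounded by the whole. *)

Section AbsoluteValue.
Variables (R : realType) (F : fieldType) (v : absolute_value R F).

Lemma absv0 : v 0 = 0. Proof. exact: (absv_eq0 v 0).2. Qed.

Lemma absv_eq0b x : (v x == 0) = (x == 0).
Proof. by apply/eqP/eqP => [/(absv_eq0 v x).1//|->]; exact: absv0. Qed.

Lemma absv_gt0 x : (0 < v x) = (x != 0).
Proof. by rewrite lt0r absv_ge0 andbT absv_eq0b. Qed.

Lemma absv1 : v 1 = 1.
Proof.
have : v 1 * v 1 = v 1 * 1 by rewrite -absvM !mulr1.
by apply: (mulfI (x := v 1)); rewrite absv_eq0b oner_eq0.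
Qed.

Lemma absvX x n : v (x ^+ n) = v x ^+ n.
Proof. by elim: n => [|n IH]; rewrite ?expr0 ?absv1// !exprS absvM IH. Qed.

Lemma absvN x : v (- x) = v x.
Proof.
rewrite -mulN1r absvM; suff -> : v (-1) = 1 by rewrite mul1r.
have /eqP : v (-1) ^+ 2 = 1 by rewrite -absvX sqrrN expr1n absv1.
rewrite sqrf_eq1 => /orP[/eqP//|/eqP vN1].
by have := absv_ge0 v (-1); rewrite vN1 oppr_ge0 leNgt ltr01.
Qed.

Lemma absvB x y : v (x - y) = v (y - x).
Proof. by rewrite -absvN opprB. Qed.

Lemma absvV x : v x^-1 = (v x)^-1.
Proof.
have [->|x0] := eqVneq x 0; first by rewrite invr0 absv0 invr0.
by apply: (mulfI (x := v x)); rewrite ?absv_eq0b// -absvM !divff ?absv_eq0b ?absv1.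
Qed.

Lemma absvXz x (z : int) : v (x ^ z) = v x ^ z.
Proof. by case: z => n; rewrite ?NegzE /exprz/= ?absvX// absvV absvX. Qed.

Lemma absv_sum (I : Type) (s : seq I) (P : pred I) (G : I -> F) :
  v (\sum_(i <- s | P i) G i) <= \sum_(i <- s | P i) v (G i).
Proof.
elim/big_ind2 : _ => //; first by rewrite absv0.
by move=> x y x' y' xy xy'; apply: le_trans (absv_triangle _ _ _) (lerD xy xy').
Qed.

Lemma absv_unity_root x n : (0 < n)%N -> x ^+ n = 1 -> v x = 1.
Proof.
move=> n0 xn; apply/eqP; rewrite -(@pexpr_eq1 _ _ n) ?absv_ge0//.
by rewrite -absvX xn absv1.
Qed.

Lemma open_absv_ball (a : F) (r : R) :
  open [set y : valued v | v (a - (y : F)) < r].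
Proof.
rewrite openE => y /= ay; apply/nbhs_ballP.
exists (r - v (a - (y : F))) => /=; first by rewrite subr_gt0.
move=> z; rewrite ballEmdist /= => yz.
have -> : a - (z : F) = (a - (y : F)) + ((y : F) - (z : F)) by rewrite addrA subrK.
by apply: le_lt_trans (absv_triangle _ _ _) _; rewrite addrC -ltrBrDr.
Qed.

Lemma cvg_absvP (u : nat -> F) (l : F) :
  (u : nat -> valued v) @ \oo --> (l : valued v) <->
  forall eps, 0 < eps -> exists N, forall n, (N <= n)%N -> v (l - u n) < eps.
Proof.
split=> [/metricType_numDomainType.cvgrPdist_lt H eps /H[N _ HN]|H].
  by exists N => n; exact: HN.
apply/metricType_numDomainType.cvgrPdist_lt => eps /H[N HN].
by exists N => // n; exact: HN.
Qed.

Definition nonarch := forall x y, v (x + y) <= Num.max (v x) (v y).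

Lemma bernoulli_ineq (h : R) n : 0 <= h -> 1 + n%:R * h <= (1 + h) ^+ n.
Proof.
move=> h0; elim: n => [|n IH]; first by rewrite mul0r addr0 expr0.
rewrite exprS -natr1.
have : (1 + h) * (1 + n%:R * h) <= (1 + h) * (1 + h) ^+ n.
  by rewrite ler_wpM2l// addr_ge0.
apply: le_trans; have : 0 <= n%:R * (h * h) by rewrite !mulr_ge0.
lra.
Qed.

Lemma le1_of_expr_le_linear (t : R) :
  0 <= t -> (forall n, t ^+ n <= n.+1%:R) -> t <= 1.
Proof.
move=> t0 ht; rewrite leNgt; apply/negP => t1.
pose h := t - 1; have h0 : 0 < h by rewrite subr_gt0.
have tE : t = 1 + h by rewrite /h addrC subrK.
(* Once k h^2 > 2, the square of 1 + k h exceeds 2k + 1, against the hypothesis at exponent 2k. *)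
have [k hk] : exists k : nat, 2 < k%:R * (h * h).
  exists (Num.bound (2 / (h * h))); rewrite -ltr_pdivrMr ?mulr_gt0//.
  by apply: archi_boundP; rewrite divr_ge0// mulr_ge0// ltW.
have [k0|k0] := eqVneq k 0%N; first by move: hk; rewrite k0 mul0r ltrn0.
have kpos : 0 < k%:R :> R by rewrite ltr0n lt0n.
have := ht (k + k)%N; rewrite exprD tE leNgt => /negP; apply.
have b := @bernoulli_ineq h k (ltW h0).
have p1 : 0 <= 1 + k%:R * h by rewrite addr_ge0// mulr_ge0// ltW.
apply: lt_le_trans (ler_pM p1 p1 b b).
rewrite -addn1 !natrD.
have : 0 < k%:R * (k%:R * (h * h) - 2) by rewrite mulr_gt0// subr_gt0.
have : 0 < k%:R * h by rewrite mulr_gt0.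
nra.
Qed.

(** Binomial coefficients have absolute value at most 1, so expanding gives [v (x + y) ^+ n] at most
    (n+1) M^n; a ratio whose powers grow at most linearly is at most 1. *)
Lemma nonarch_of_nat : (forall n : nat, v n%:R <= 1) -> nonarch.
Proof.
move=> vn x y; set M := Num.max _ _.
have M0 : 0 <= M by rewrite le_max absv_ge0.
have [M00|Mn0] := eqVneq M 0.
  have x0 : v x <= 0 by rewrite -M00 le_max lexx.
  have y0 : v y <= 0 by rewrite -M00 le_max lexx orbT.
  by apply: le_trans (absv_triangle _ _ _) _; rewrite M00 -(addr0 0) lerD.
have Mp : 0 < M by rewrite lt0r Mn0.
suff : v (x + y) / M <= 1 by rewrite ler_pdivrMr// mul1r.
apply: le1_of_expr_le_linear => [|n]; first by rewrite divr_ge0 ?absv_ge0.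
rewrite expr_div_n ler_pdivrMr ?exprn_gt0// -absvX exprDn.
apply: le_trans (absv_sum _ _ _) _.
have -> : n.+1%:R * M ^+ n = \sum_(i < n.+1) M ^+ n.
  by rewrite sumr_const card_ord mulr_natl.
apply: ler_sum => i _; rewrite -mulr_natr !absvM !absvX.
have -> : M ^+ n = M ^+ (n - i) * M ^+ i * 1.
  by rewrite mulr1 -exprD subnK// -ltnS.
by rewrite ler_pM ?mulr_ge0 ?exprn_ge0 ?absv_ge0// ler_pM ?exprn_ge0 ?absv_ge0//
  lerXn2r ?nnegrE ?absv_ge0// le_max lexx ?orbT.
Qed.

Hypothesis na : nonarch.

Lemma nonarch_le x y r : v x <= r -> v y <= r -> v (x + y) <= r.
Proof. by move=> xr yr; apply: le_trans (na _ _) _; rewrite ge_max xr. Qed.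

Lemma nonarch_lt x y r : v x < r -> v y < r -> v (x + y) < r.
Proof. by move=> xr yr; apply: le_lt_trans (na _ _) _; rewrite gt_max xr. Qed.

Lemma nonarch_ltB x y z r : v (x - y) < r -> v (y - z) < r -> v (x - z) < r.
Proof. by move=> xr yr; rewrite -(subrK y x) -addrA nonarch_lt. Qed.

Lemma nonarch_sum_le (I : Type) (s : seq I) (P : pred I) (G : I -> F) r :
  0 <= r -> (forall i, P i -> v (G i) <= r) -> v (\sum_(i <- s | P i) G i) <= r.
Proof.
move=> r0 Gr; elim/big_ind : _ => //; first by rewrite absv0.
by move=> x y; exact: nonarch_le.
Qed.

Lemma nonarch_sum_lt (I : Type) (s : seq I) (P : pred I) (G : I -> F) r :
  0 < r -> (forall i, P i -> v (G i) < r) -> v (\sum_(i <- s | P i) G i) < r.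
Proof.
move=> r0 Gr; elim/big_ind : _ => //; first by rewrite absv0.
by move=> x y; exact: nonarch_lt.
Qed.

Lemma nonarch_eqD x y : v y < v x -> v (x + y) = v x.
Proof.
move=> yx; apply/eqP; rewrite eq_le nonarch_le// ?(ltW yx)//=.
rewrite leNgt; apply/negP => xyx.
have : v (x + y - y) < v x by rewrite nonarch_lt// absvN.
by rewrite addrK ltxx.
Qed.

Lemma nonarch_eq x y : v (x - y) < v x -> v y = v x.
Proof. by move=> xy; rewrite -(@nonarch_eqD x (- (x - y))) ?absvN// opprB addrC subrK. Qed.

(** A nonzero term of largest absolute value strictly dominates all the others, so the whole sum has
    its absolute value. *)
Lemma absv_le_sum_of_distinct (I : finType) (G : I -> F) :
  (forall i j, G i != 0 -> v (G i) = v (G j) -> i = j) ->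
  forall i, v (G i) <= v (\sum_j G j).
Proof.
move=> inj i.
case: (@arg_maxP _ _ I i xpredT (fun j => v (G j)) isT) => i0 _ i0max'.
have i0max j : v (G j) <= v (G i0) := i0max' j isT.
have [Gi0|Gi0] := eqVneq (G i0) 0.
  by apply: le_trans (i0max _) _; rewrite Gi0 absv0 absv_ge0.
apply: le_trans (i0max _) _.
rewrite (bigD1 i0)//= nonarch_eqD// nonarch_sum_lt// ?absv_gt0// => j ji0.
rewrite lt_neqAle i0max andbT; apply: contra ji0 => /eqP vij.
by apply/eqP/esym; apply: inj.
Qed.

End AbsoluteValue.

(** * p-adic numbers *)

Section Padic.
Variables (R : realType) (p : nat) (p_prime : prime p).
Variables (Qp : fieldType) (vp : absolute_value R Qp).
Hypothesis Qp_padic : padic_completion p vp.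

Lemma padic_p_gt0 : 0 < p%:R :> R.
Proof. by rewrite ltr0n prime_gt0. Qed.

Lemma padic_p_gt1 : 1 < p%:R :> R.
Proof. by rewrite ltr1n prime_gt1. Qed.

Lemma padic_abs_nat n : (0 < n)%N -> vp n%:R = p%:R ^- (logn p n).
Proof.
move=> n0; have [H _ _] := Qp_padic.
have -> : n%:R = ratr n%:R :> Qp.
  have -> : n%:R = n%:Z%:~R :> rat by rewrite pmulrn.
  by rewrite /ratr numq_int denq_int divr1.
rewrite H /padic_abs pnatr_eq0 -[n == _]negbK -lt0n n0/=.
have -> : n%:R = n%:Z%:~R :> rat by rewrite pmulrn.
by rewrite numq_int denq_int/= logn1 sub0r -invr_expz.
Qed.

Lemma padic_nat_le1 n : vp n%:R <= 1.
Proof.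
case: n => [|n]; first by rewrite absv0.
by rewrite padic_abs_nat// invf_le1 ?exprn_gt0 ?padic_p_gt0// exprn_ege1// ltW ?padic_p_gt1.
Qed.

Lemma padic_nonarch : nonarch vp.
Proof. exact: nonarch_of_nat padic_nat_le1. Qed.

Lemma padic_abs_p : vp p%:R = p%:R^-1.
Proof. by rewrite padic_abs_nat ?prime_gt0// logn_prime// eqxx expr1. Qed.

Lemma padic_p_neq0 : p%:R != 0 :> Qp.
Proof. by rewrite -(absv_eq0b vp) padic_abs_p invr_eq0 gt_eqF// padic_p_gt0. Qed.

Lemma padic_abs_pXz (z : int) : vp (p%:R ^ z) = p%:R ^ (- z).
Proof. by rewrite absvXz padic_abs_p exprz_inv. Qed.

Lemma padic_pV_lt1 : p%:R^-1 < 1 :> R.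
Proof. by rewrite invf_lt1 ?padic_p_gt0// padic_p_gt1. Qed.

Lemma padic_p_lt1 : vp p%:R < 1.
Proof. by rewrite padic_abs_p padic_pV_lt1. Qed.

Lemma padic_lt1_pexp n k : (vp n%:R < p%:R ^- k) = (p ^ k.+1 %| n)%N.
Proof.
case: n => [|n].
  by rewrite absv0 invr_gt0 exprn_gt0 ?padic_p_gt0// dvdn0.
rewrite padic_abs_nat// ltf_pV2 ?posrE ?exprn_gt0 ?padic_p_gt0//.
by rewrite ltr_eXn2l ?padic_p_gt1// pfactor_dvdn.
Qed.

Lemma padic_nat_lt1 n : (vp n%:R < 1) = (p %| n)%N.
Proof. by have := padic_lt1_pexp n 0; rewrite expr0 invr1 expn1. Qed.

Lemma padic_approx x (eps : R) : 0 < eps -> exists q : rat, vp (x - ratr q) < eps.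
Proof.
move=> e0; have [_ H _] := Qp_padic.
have [] := H _ _ (@open_absv_ball _ _ vp x eps).
  by exists x => /=; rewrite subrr absv0.
by move=> y [/= xy [q _ qy]]; exists q; rewrite qy; exact: xy.
Qed.

(** A rational number closer to [x] than the size of [x] has the same absolute value. *)
Lemma padic_value x : x != 0 -> exists z : int, vp x = p%:R ^ z.
Proof.
move=> x0; have vx0 : 0 < vp x by rewrite absv_gt0.
have [q xq] := padic_approx x vx0.
have qx := nonarch_eq padic_nonarch xq; rewrite -qx.
have q0 : q != 0.
  apply: contraTneq vx0 => q0; rewrite -qx q0 /ratr.
  by rewrite (_ : numq 0 = 0)// mul0r absv0 ltxx.
by have [-> _ _] := Qp_padic; rewrite /padic_abs (negbTE q0); eexists.
Qed.

(** A nearby rational also has absolute value at most 1, so its reduced denominator is prime to [p];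
    the digit is the numerator times an inverse of the denominator modulo [p]. *)
Lemma padic_digit x : vp x <= 1 -> exists d : 'I_p, vp (x - d%:R) < 1.
Proof.
move=> x1; have [q xq] := padic_approx x ltr01.
suff [d qd] : exists d : 'I_p, vp (ratr q - d%:R) < 1.
  by exists d; apply: (nonarch_ltB padic_nonarch xq).
have q1 : vp (ratr q) <= 1.
  rewrite -[ratr q](subrK x) nonarch_le//; first exact: padic_nonarch.
  by rewrite absvB ltW.
set D := `|denq q|%N.
have D0 : (0 < D)%N by rewrite absz_gt0 denq_neq0.
have DE : denq q = D%:Z by rewrite /D absz_denq.
have pD : ~~ (p %| D)%N.
  apply/negP => pD; have [H _ _] := Qp_padic.
  have q0 : q != 0.
    apply/eqP => q0; move: pD; rewrite /D q0 (_ : denq 0 = 1)//= dvdn1.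
    by rewrite gtn_eqF ?prime_gt1.
  have pN : logn p `|numq q|%N = 0%N.
    apply/eqP; rewrite -leqn0 leqNgt -pfactor_dvdn ?absz_gt0 ?numq_eq0// expn1.
    apply/negP => pN; move: (prime_gt1 p_prime); rewrite ltnNge dvdn_leq//.
    by rewrite -(eqP (coprime_num_den q)) dvdn_gcd pN.
  move: q1; rewrite H /padic_abs (negbTE q0) pN subr0 leNgt => /negP; apply.
  by rewrite -exprnP exprn_egt1 ?padic_p_gt1// -lt0n -pfactor_dvdn// expn1.
have vD : vp D%:R = 1.
  by apply/eqP; rewrite eq_le padic_nat_le1 leNgt padic_nat_lt1.
have DR0 : D%:R != 0 :> Qp by rewrite -(absv_eq0b vp) vD oner_eq0.
have vmulp n : vp (n * p)%:R < 1 by rewrite padic_nat_lt1 dvdn_mull.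
have [n zn] : exists n : nat, vp ((numq q)%:~R - n%:R) < 1.
  (* The added multiple of [p] keeps the residue and makes the integer nonnegative. *)
  pose z : int := numq q + (`|numq q|%N * p)%N%:Z.
  exists `|z|%N.
  rewrite pmulrn gez0_abs /z; last first.
    by have := prime_gt0 p_prime; nia.
  by rewrite /z intrD opprD addNKr absvN -pmulrn.
have [u vu] : exists u : nat, vp (D%:R^-1 - u%:R) < 1.
  have cpD : coprime p D by rewrite prime_coprime.
  have [u w E _] := egcdnP p D0.
  exists u.
  have -> : D%:R^-1 - u%:R = - (D%:R^-1 * (w * p)%N%:R) :> Qp.
    apply: (mulfI DR0); rewrite mulrBr mulfV// mulrN mulVKf// -natrM mulnC E.
    by rewrite gcdnC (eqP cpD) natrD opprD addrC subrK.
  by rewrite absvN absvM absvV vD invr1 mul1r vmulp.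
exists (Ordinal (ltn_pmod (n * u) (prime_gt0 p_prime))) => /=.
apply: (@nonarch_ltB _ _ vp padic_nonarch _ (n * u)%:R); last first.
  by rewrite {1}(divn_eq (n * u) p) natrD addrK vmulp.
apply: (@nonarch_ltB _ _ vp padic_nonarch _ (n%:R / D%:R)).
  by rewrite /ratr DE -mulrBl absvM absvV -pmulrn vD invr1 mulr1.
by rewrite natrM -mulrBr absvM; apply: le_lt_trans vu; rewrite ler_piMl ?absv_ge0 ?padic_nat_le1.
Qed.
End Padic.

(** * Digit expansions and integral parts in the p-adic numbers *)

Section PadicFloor.
Variables (R : realType) (p : nat) (p_prime : prime p).
Variables (Qp : fieldType) (vp : absolute_value R Qp).
Hypothesis Qp_padic : padic_completion p vp.

Let p_neq0 : p%:R != 0 :> Qp := padic_p_neq0 p_prime Qp_padic.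
Let p_gt0 : 0 < p%:R :> R := padic_p_gt0 R p_prime.
Let na := padic_nonarch p_prime Qp_padic.

(* the possible values of a p-adic integral part *)
Definition padic_frac (y : Qp) : Prop :=
  exists N k : nat, (N < p ^ k.+1)%N /\ y = N%:R / p%:R ^+ k.

(** Over the denominator p^(k+k'), the numerator of the difference is below p^(k+k'+1), yet
    divisible by that power as soon as the difference has absolute value below 1. *)
Lemma padic_frac_eq y y' :
  padic_frac y -> padic_frac y' -> vp (y - y') < 1 -> y = y'.
Proof.
move=> [N [k [Nk ->]]] [N' [k' [Nk' ->]]].
wlog le : N k N' k' Nk Nk' / (N' * p ^ k <= N * p ^ k')%N.
  move=> H; case: (leqP (N' * p ^ k) (N * p ^ k')) => [|/ltnW] le; first exact: H.
  by rewrite absvB => h; apply/esym/H.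
have -> : N%:R / p%:R ^+ k - N'%:R / p%:R ^+ k' =
    (N * p ^ k' - N' * p ^ k)%N%:R / p%:R ^+ (k + k') :> Qp.
  rewrite natrB// !natrM !natrX exprD; field.
  by rewrite !expf_neq0.
rewrite absvM absvV absvX (padic_abs_p p_prime Qp_padic) exprVn invrK.
rewrite -ltr_pdivlMr ?exprn_gt0// div1r (padic_lt1_pexp p_prime Qp_padic) => dv.
have lt : (N * p ^ k' < p ^ (k + k').+1)%N.
  by rewrite -addSn expnD ltn_pmul2r ?expn_gt0 ?prime_gt0.
have E : (N * p ^ k' = N' * p ^ k)%N.
  apply/eqP; rewrite eqn_leq le andbT -subn_eq0 -leqn0 leqNgt; apply/negP => gt0.
  by have := leq_ltn_trans (leq_subr (N' * p ^ k) _) lt; rewrite ltnNge (dvdn_leq gt0 dv).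
have /(congr1 (fun n : nat => n%:R : Qp)) := E; rewrite !natrM !natrX => E'.
apply: (mulIf (x := p%:R ^+ k * p%:R ^+ k')); first by rewrite mulf_neq0 ?expf_neq0.
transitivity (N%:R * p%:R ^+ k' : Qp); first by field; rewrite expf_neq0.
by rewrite E'; field; rewrite expf_neq0.
Qed.

Lemma padic_sum_digits_lt (d : nat -> nat) n :
  (forall j, d j < p)%N -> (\sum_(i < n) d i * p ^ i < p ^ n)%N.
Proof.
move=> dp; elim: n => [|n IH]; first by rewrite big_ord0.
rewrite big_ord_recr/= expnS.
apply: (@leq_trans (p ^ n + d n * p ^ n)); first by rewrite ltn_add2r.
by rewrite -mulSn leq_mul2r dp orbT.
Qed.

Lemma padic_expansion_floor n0 d b : padic_expansion p vp n0 d b ->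
  let y := \sum_(i < `|n0|%N.+1 | n0 + i%:Z <= 0) (d (n0 + i%:Z))%:R * p%:R ^ (n0 + i%:Z) in
  padic_frac y /\ vp (b - y) < 1.
Proof.
move=> [dp db] /=; set y := \sum_(i < _ | _) _; split.
  have [n0gt|n0le] := ltP 0 n0.
    exists 0%N, 0%N; rewrite expn1 prime_gt0//; split=> //.
    by rewrite mul0r /y big_pred0// => i; apply/negbTE; rewrite -ltNge ltr_pwDl.
  set k := `|n0|%N; have n0E : n0 = - k%:Z by rewrite /k; lia.
  exists (\sum_(i < k.+1) d (n0 + i%:Z)%R * p ^ i)%N, k; split.
    by apply: (@padic_sum_digits_lt (fun i => d (n0 + i%:Z))).
  rewrite natr_sum mulr_suml /y (eq_bigl xpredT); last by move=> i; have := ltn_ord i; lia.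
  apply: eq_bigr => i _; rewrite natrM -mulrA; congr (_ * _).
  move: (nat_of_ord i) => j.
  by rewrite natrX n0E addrC expfzDr// -exprnP -invr_expz.
(* A partial sum reaching past [|n0|] contains every term of [y], and its remaining terms carry
   positive powers of [p]; far enough, it is also within distance 1 of [b]. *)
pose S n : Qp := \sum_(i < n) (d (n0 + i%:Z))%:R * p%:R ^ (n0 + i%:Z).
have [n [nk bSn]] : exists n, (`|n0|%N < n)%N /\ vp (b - S n) < 1.
  have /(@cvg_absvP _ _ vp _ _).1 /(_ 1 ltr01) [m hm] := db.
  exists (maxn m `|n0|%N.+1); split; first by rewrite leq_maxr.
  by apply: hm; rewrite leq_maxl.
rewrite -(subrK (S n) b) -addrA; apply: nonarch_lt => //.
have -> : y = \sum_(i < n | n0 + i%:Z <= 0) (d (n0 + i%:Z))%:R * p%:R ^ (n0 + i%:Z).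
  pose G i : Qp := (d (n0 + i%:Z))%:R * p%:R ^ (n0 + i%:Z).
  rewrite /y (big_ord_widen_cond n (fun i => n0 + i%:Z <= 0) G)//.
  by apply: eq_bigl => i; have := ltn_ord i; lia.
rewrite /S (bigID (fun i : 'I_n => n0 + i%:Z <= 0))/= [X in X - _]addrC addrK.
apply: nonarch_sum_lt => // i; rewrite -ltNge => i0.
rewrite absvM; apply: (@le_lt_trans _ _ (vp (p%:R ^ (n0 + i%:Z)))).
  by rewrite ler_piMl ?absv_ge0// (padic_nat_le1 p_prime Qp_padic).
have [j ->] : exists j : nat, n0 + i%:Z = j.+1%:Z.
  by exists (absz (n0 + i%:Z)).-1; lia.
by rewrite -exprnP absvX exprn_ilt1 ?absv_ge0 ?(padic_p_lt1 p_prime Qp_padic).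
Qed.

Lemma padic_expansion_exists b : exists n0 d, padic_expansion p vp n0 d b.
Proof.
have [n0 bn0] : exists n0 : int, vp b <= p%:R ^ (- n0).
  have [->|b0] := eqVneq b 0.
    by exists 0; rewrite absv0 oppr0 expr0z ler01.
  by have [z ->] := padic_value p_prime Qp_padic b0; exists (- z); rewrite opprK.
have dig (x : Qp) : exists d : 'I_p, vp x <= 1 -> vp (x - d%:R) < 1.
  have [x1|x1] := leP (vp x) 1; last by exists (Ordinal (prime_gt0 p_prime)).
  by have [d xd] := padic_digit p_prime Qp_padic x1; exists d.
have [D DP] := choice dig.
(* [X n] is what remains of [b] after [n] digits, divided by p^(n0+n) so as to stay of absolute
   value at most 1. *)
pose X := fix X n : Qp := if n is n'.+1 then (X n' - (D (X n'))%:R) / p%:R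
                         else b / p%:R ^ n0.
have X1 n : vp (X n) <= 1.
  elim: n => [|n IH] /=.
    rewrite absvM absvV (padic_abs_pXz p_prime Qp_padic) invr_expz opprK.
    by rewrite -ler_pdivlMr ?exprz_gt0// div1r invr_expz.
  rewrite absvM absvV (padic_abs_p p_prime Qp_padic) invrK.
  have [->|x0] := eqVneq (X n - (D (X n))%:R) 0; first by rewrite absv0 mul0r.
  (* Values are integral powers of [p]: below 1 means at most 1/p, which pays for the division by
     [p]. *)
  have := DP _ IH; have [z ->] := padic_value p_prime Qp_padic x0.
  rewrite -[1]/(p%:R ^ 0) ltr_eXz2l ?(padic_p_gt1 R p_prime)// => z0.
  by rewrite -[X in _ * X]expr1z -expfzDr ?gt_eqF// ler_eXz2l ?(padic_p_gt1 R p_prime)//; lia.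
exists n0, (fun j => D (X (absz (j - n0)%R)) : nat); split; first by move=> j; exact: ltn_ord.
have E n : b - \sum_(i < n) (nat_of_ord (D (X (absz (n0 + i%:Z - n0)%R))))%:R * p%:R ^ (n0 + i%:Z)
     = X n * p%:R ^ (n0 + n%:Z).
  elim: n => [|n IH].
    by rewrite big_ord0 subr0 addr0 /= divfK// expfz_neq0.
  rewrite big_ord_recr opprD addrA IH/= [n0 + n%:Z - n0]addrAC subrr add0r absz_nat.
  have -> : n0 + n.+1%:Z = n0 + n%:Z + 1 by lia.
  rewrite -mulrBl (expfzDr (n0 + n%:Z))// expr1z.
  by field.
apply/(@cvg_absvP _ _ vp _ _) => eps eps0.
have [N hN] : exists N : nat, p%:R ^- N < eps * p%:R ^ n0.
  have e1 : 0 < eps * p%:R ^ n0 by rewrite mulr_gt0// exprz_gt0.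
  pose M := Num.bound (eps * p%:R ^ n0)^-1; exists M.
  rewrite invf_plt ?posrE ?exprn_gt0//.
  apply: lt_trans (archi_boundP _) _; first by rewrite invr_ge0 ltW.
  by rewrite -natrX ltr_nat ltn_expl// prime_gt1.
exists N => n Nn; rewrite E absvM (padic_abs_pXz p_prime Qp_padic).
apply: (@le_lt_trans _ _ (p%:R ^ (- (n0 + n%:Z)))).
  by rewrite ler_piMl// exprz_ge0// ltW.
rewrite opprD expfzDr ?gt_eqF// mulrC -ltr_pdivlMr ?exprz_gt0//.
rewrite invr_expz opprK -invr_expz -exprnP; apply: le_lt_trans hN.
by rewrite lef_pV2 ?posrE ?exprn_gt0// ler_weXn2l// ltW// (padic_p_gt1 R p_prime).
Qed.

Lemma padic_floorP b :
  padic_frac (padic_floor p vp b) /\ vp (b - padic_floor p vp b) < 1.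
Proof.
rewrite /padic_floor; case: xgetP => [y _ [n0 [d [/padic_expansion_floor H ->]]]|] //.
have [n0 [d nd]] := padic_expansion_exists b.
by move=> /(_ _) /(_ (ex_intro _ n0 (ex_intro _ d (conj nd erefl)))).
Qed.

Lemma padic_floor_lt1 b : vp (b - padic_floor p vp b) < 1.
Proof. exact: (padic_floorP b).2. Qed.

Lemma padic_floor_eq b b' : vp (b - b') < 1 -> padic_floor p vp b = padic_floor p vp b'.
Proof.
move=> bb'; have [fb lb] := padic_floorP b; have [fb' lb'] := padic_floorP b'.
apply: padic_frac_eq => //; apply: (nonarch_ltB na _ lb').
by apply: (nonarch_ltB na _ bb'); rewrite absvB.
Qed.

End PadicFloor.

(** * The local field K *)

Section BasisLinear.
Variables (Qp : fieldType) (K : fieldExtType Qp) (e f : nat) (gamma beta : K).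

(** Coefficients are packed in a matrix so that rank-nullity applies to the combination map. *)
Definition basis_comb_mx (M : 'M[Qp]_(e, f)) : K :=
  basis_comb gamma beta (fun i j => M i j).

Lemma basis_comb_mx_is_linear : linear basis_comb_mx.
Proof.
move=> a M N; rewrite /basis_comb_mx /basis_comb scaler_sumr -big_split/=.
apply: eq_bigr => i _; rewrite scaler_sumr -big_split/=.
by apply: eq_bigr => j _; rewrite !mxE scalerDl scalerA.
Qed.

HB.instance Definition _ :=
  GRing.isLinear.Build Qp 'M[Qp]_(e, f) K _ basis_comb_mx basis_comb_mx_is_linear.

Lemma basis_comb_surj : \dim {:K} = (e * f)%N ->
  (forall b : 'I_e -> 'I_f -> Qp, basis_comb gamma beta b = 0 -> forall i j, b i j = 0) ->
  forall x : K, exists b : 'I_e -> 'I_f -> Qp, x = basis_comb gamma beta b.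
Proof.
move=> dK inj x; pose L := linfun basis_comb_mx.
have ker0 : lker L = 0%VS.
  apply/eqP; rewrite -subv0; apply/subvP => M.
  rewrite memv_ker lfunE/= memv0 => /eqP M0.
  by apply/eqP/matrixP => i j; rewrite mxE (inj _ M0).
have dL : \dim (limg L) = (e * f)%N.
  by have := limg_ker_dim L fullv; rewrite ker0 capv0 dimv0 add0n dimvf /dim/= => ->.
have : x \in limg L.
  have /eqP -> : limg L == fullv by rewrite eqEdim subvf dL dK leqnn.
  exact: memvf.
by move=> /memv_imgP[M _ ->]; exists (fun i j => M i j); rewrite lfunE.
Qed.

End BasisLinear.

Lemma unity_root_geometric (K : fieldType) (z : K) n :
  z ^+ n = 1 -> z != 1 -> \sum_(i < n) z ^+ i = 0.
Proof.
move=> zn z1; have /eqP := subrX1 z n; rewrite zn subrr eq_sym mulf_eq0 subr_eq0.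
by rewrite (negbTE z1)/= => /eqP.
Qed.

Section LocalField.
Variables (R : realType) (p : nat) (p_prime : prime p).
Variables (Qp : fieldType) (vp : absolute_value R Qp).
Hypothesis Qp_padic : padic_completion p vp.
Variables (K : fieldExtType Qp) (v : absolute_value R K).
Hypothesis v_ext : forall x : Qp, v x%:A = vp x.
Variables (e f : nat).
Hypothesis K_dim : \dim {:K} = (e * f)%N.
Variables (gamma beta : K).
Hypothesis gamma_root : (p ^ f - 1)%N.-primitive_root gamma.
Hypothesis beta_abs : v beta = p%:R `^ (e%:R^-1).

Let p_gt0 : 0 < p%:R :> R := padic_p_gt0 R p_prime.
Let p_gt1 : 1 < p%:R :> R := padic_p_gt1 R p_prime.

Lemma ext_nat n : v n%:R = vp n%:R.
Proof. by rewrite -v_ext scaler_nat. Qed.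

Lemma ext_nonarch : nonarch v.
Proof. by apply: nonarch_of_nat => n; rewrite ext_nat (padic_nat_le1 p_prime). Qed.
Let na := ext_nonarch.

Lemma ext_scale c x : v (c *: x) = vp c * v x.
Proof. by rewrite -mulr_algl absvM v_ext. Qed.

Lemma ext_ef_gt0 : (0 < e)%N /\ (0 < f)%N.
Proof.
apply/andP; rewrite -muln_gt0 -K_dim lt0n dimv_eq0 -subv0.
by apply/negP => /subvP /(_ 1 (memvf _)); rewrite memv0 oner_eq0.
Qed.
Let e_gt0 := ext_ef_gt0.1.
Let f_gt0 := ext_ef_gt0.2.

Lemma gamma_abs : v gamma = 1.
Proof.
by apply: absv_unity_root (prim_order_gt0 gamma_root) (prim_expr_order gamma_root).
Qed.

Lemma gammaX_abs n : v (gamma ^+ n) = 1.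
Proof. by rewrite absvX gamma_abs expr1n. Qed.

Lemma order_gamma_abs : v (p ^ f - 1)%:R = 1.
Proof.
rewrite ext_nat; apply/eqP.
rewrite eq_le (padic_nat_le1 p_prime)//= leNgt (padic_nat_lt1 p_prime)//.
have pf : (p %| p ^ f)%N by rewrite dvdn_exp.
have pf0 : (0 < p ^ f)%N by rewrite expn_gt0 prime_gt0.
apply/negP => h; have := dvdn_sub pf h.
by rewrite subKn// dvdn1 gtn_eqF// prime_gt1.
Qed.

(* Distinct powers of gamma stay distinct in the residue field: if z = gamma^k
   were congruent to 1, then 1 + z + ... + z^(N-1) = 0 would be congruent to the
   unit N = p^f - 1. *)
Lemma gammaX_sub_abs (k l : 'I_(p ^ f - 1)) :
  v (gamma ^+ k - gamma ^+ l) < 1 -> k = l.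
Proof.
wlog le : k l / (k <= l)%N.
  move=> H; case: (leqP k l) => [|/ltnW] le; first exact: H.
  by rewrite absvB => h; apply/esym/H.
have -> : gamma ^+ k - gamma ^+ l = gamma ^+ k * (1 - gamma ^+ (l - k)).
  by rewrite mulrBr mulr1 -exprD subnKC.
rewrite absvM gammaX_abs mul1r absvB => lt1; apply/val_inj/eqP.
rewrite eqn_leq le/= -subn_eq0 -leqn0 leqNgt; apply/negP => lk0.
set z := gamma ^+ (l - k) in lt1.
have zN : z ^+ (p ^ f - 1) = 1.
  by rewrite /z exprAC (prim_expr_order gamma_root) expr1n.
have z1 : z != 1.
  rewrite -(prim_order_dvd gamma_root); apply/negP => /(dvdn_leq lk0).
  by rewrite leqNgt (leq_ltn_trans (leq_subr _ _) (ltn_ord l)).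
have := order_gamma_abs; rewrite -[_%:R]subr0 -(unity_root_geometric zN z1).
have -> : (p ^ f - 1)%:R = \sum_(i < p ^ f - 1) 1 :> K by rewrite sumr_const card_ord.
rewrite -sumrB => E; suff : v (\sum_(i < p ^ f - 1) (1 - z ^+ i)) < 1 by rewrite E ltxx.
apply: nonarch_sum_lt => // i _.
rewrite absvB subrX1 absvM; apply: le_lt_trans lt1; rewrite ler_piMr ?absv_ge0//.
apply: nonarch_sum_le => // j _.
by rewrite /z -exprM gammaX_abs.
Qed.

(** * Independence of the powers of gamma in the residue field *)

Section ResidueRelation.
Variables (d : nat) (c : 'I_d -> Qp).
Hypothesis c_le1 : forall j, vp (c j) <= 1.
Hypothesis rel : v (gamma ^+ d - \sum_j c j *: gamma ^+ j) < 1.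

(** Says, without constructing the residue field, that the class of [x] lies in the span of the
    first [d] powers of [gamma] over the residue field of [Qp]. *)
Definition residue_span (x : K) : Prop :=
  exists2 a : 'I_d -> Qp, forall j, vp (a j) <= 1 & v (x - \sum_j a j *: gamma ^+ j) < 1.

Lemma residue_span_sum (I : Type) (s : seq I) (b : I -> Qp) (G : I -> K) :
  (forall i, vp (b i) <= 1) -> (forall i, residue_span (G i)) ->
  residue_span (\sum_(i <- s) b i *: G i).
Proof.
move=> b1 sG; elim: s => [|i s [a a1 ha]].
  exists (fun=> 0) => [j|]; first by rewrite absv0.
  by rewrite big_nil big1 ?subrr ?absv0// => j _; rewrite scale0r.
have [a' a1' ha'] := sG i.
exists (fun j => b i * a' j + a j) => [j|].
  apply: nonarch_le => //; first exact: padic_nonarch Qp_padic.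
  by rewrite absvM mulr_ile1 ?absv_ge0.
rewrite big_cons.
have -> : \sum_j (b i * a' j + a j) *: gamma ^+ j =
    b i *: (\sum_j a' j *: gamma ^+ j) + \sum_j a j *: gamma ^+ j.
  by rewrite scaler_sumr -big_split/=; apply: eq_bigr => j _; rewrite scalerDl scalerA.
rewrite opprD addrACA -scalerBr; apply: nonarch_lt => //.
by rewrite ext_scale; apply: le_lt_trans ha'; rewrite ler_piMl ?absv_ge0.
Qed.

(** For n >= d, the relation multiplied by gamma^(n-d) expresses gamma^n through lower powers modulo
    the maximal ideal; strong induction does the rest. *)
Lemma residue_span_gammaX n : residue_span (gamma ^+ n).
Proof.
have [m le_nm] := ubnP n; elim: m => // m IH in n le_nm *.
have [nd|dn] := ltnP n d.
  exists (fun j => (j == Ordinal nd)%:R) => [j|].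
    by case: eqP; rewrite ?absv1 ?absv0.
  rewrite (bigD1 (Ordinal nd))//= eqxx scale1r big1 ?addr0 ?subrr ?absv0// => j /negbTE ->.
  by rewrite scale0r.
have [a a1 ha] : residue_span (\sum_j c j *: gamma ^+ (n - d + j)).
  apply: (@residue_span_sum _ _ c (fun j : 'I_d => gamma ^+ (n - d + j))) => // j.
  by apply: IH; have := ltn_ord j; lia.
exists a => //; apply: (nonarch_ltB na _ ha).
have -> : gamma ^+ n - \sum_j c j *: gamma ^+ (n - d + j) =
    gamma ^+ (n - d) * (gamma ^+ d - \sum_j c j *: gamma ^+ j).
  rewrite mulrBr -exprD subnK// mulr_sumr; congr (_ - _).
  by apply: eq_bigr => j _; rewrite exprD scalerAr.
by rewrite absvM gammaX_abs mul1r.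
Qed.

Lemma residue_span_digits x : residue_span x ->
  exists a : {ffun 'I_d -> 'I_p}, v (x - \sum_j (a j)%:R *: gamma ^+ j) < 1.
Proof.
move=> [b b1 hb]; have dig j : exists y : 'I_p, vp (b j - y%:R) < 1.
  exact: padic_digit.
have [a ha] := choice dig; exists [ffun j => a j].
apply: (nonarch_ltB na hb); rewrite -sumrB; apply: nonarch_sum_lt => // j _.
by rewrite ffunE -scalerBl ext_scale gammaX_abs mulr1.
Qed.

(* The residues of 0 and of the powers of gamma are p^f elements lying in a space
   of size p^d. *)
Lemma residue_relation_degree : (f <= d)%N.
Proof.
pose G (i : option 'I_(p ^ f - 1)) : K := if i is Some k then gamma ^+ k else 0.
have Gdig i : exists a : {ffun 'I_d -> 'I_p}, v (G i - \sum_j (a j)%:R *: gamma ^+ j) < 1.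
  apply: residue_span_digits; case: i => [k|] /=; first exact: residue_span_gammaX.
  exists (fun=> 0) => [j|]; first by rewrite absv0.
  by rewrite big1 ?subrr ?absv0// => j _; rewrite scale0r.
have [h hh] := choice Gdig.
have Ginj i j : v (G i - G j) < 1 -> i = j.
  case: i j => [k|] [l|] //=; first by move=> /gammaX_sub_abs ->.
    by rewrite subr0 gammaX_abs ltxx.
  by rewrite sub0r absvN gammaX_abs ltxx.
have hinj : injective h.
  move=> i j hij; apply: Ginj; apply: (nonarch_ltB na (hh i)).
  by rewrite hij absvB.
have := leq_card h hinj; rewrite card_option card_ffun !card_ord.
rewrite subn1 prednK ?expn_gt0 ?prime_gt0//.
by rewrite leq_exp2l// prime_gt1.
Qed.

End ResidueRelation.

(** Let [d] be the largest index with a coefficient of absolute value 1. The terms above it are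
    negligible, and dividing by [c d] expresses gamma^d through lower powers modulo the maximal
    ideal; this forces f <= d, while d < f. *)
Lemma gamma_residue_free (c : 'I_f -> Qp) : (forall j, vp (c j) <= 1) ->
  v (\sum_j c j *: gamma ^+ j) < 1 -> forall j, vp (c j) < 1.
Proof.
move=> c1 lt1 j; rewrite ltNge; apply/negP => cj.
case: (@arg_maxnP _ j (fun j => 1 <= vp (c j)) (fun j => j : nat) cj) => d d1 dmax.
have cd1 : vp (c d) = 1 by apply/eqP; rewrite eq_le c1.
have df : (d <= f)%N by rewrite ltnW.
have := ltn_ord d; rewrite ltnNge => /negP; apply.
pose c' (i : 'I_d) := - (c d)^-1 * c (widen_ord df i).
apply: (@residue_relation_degree d c').
  by move=> i; rewrite absvM absvN absvV cd1 invr1 mul1r.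
have cd0 : c d != 0 by rewrite -(absv_eq0b vp) cd1 oner_eq0.
pose S := \sum_(i < f | (d < i)%N) c i *: gamma ^+ i.
have -> : gamma ^+ d - \sum_i c' i *: gamma ^+ i =
    (c d)^-1 *: (\sum_i c i *: gamma ^+ i - S).
  rewrite (bigID (fun i : 'I_f => (d < i)%N))/= -/S addrAC subrr add0r.
  rewrite (bigD1 d) ?ltnn//= scalerDr scalerA mulVf// scale1r; congr (_ + _).
  rewrite scaler_sumr -sumrN.
  rewrite [in RHS](eq_bigl (fun i : 'I_f => (i < d)%N)); last first.
    by move=> i; rewrite -(inj_eq val_inj)/=; lia.
  rewrite (big_ord_narrow df)/=; apply: eq_bigr => i _.
  by rewrite /c' scalerA mulNr scaleNr opprK.
rewrite ext_scale absvV cd1 invr1 mul1r; apply: nonarch_lt => //.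
rewrite absvN; apply: nonarch_sum_lt => // i di.
rewrite ext_scale gammaX_abs mulr1 ltNge; apply/negP => /(dmax i)/=.
by rewrite leqNgt di.
Qed.

(** The first [f] powers of [gamma] are orthonormal in the ultrametric sense: if the combination
    were smaller than its largest coefficient, dividing by that coefficient would contradict
    [gamma_residue_free]. *)
Lemma gamma_comb_abs (c : 'I_f -> Qp) :
  (forall j, vp (c j) <= v (\sum_j c j *: gamma ^+ j)) /\
  exists j, v (\sum_j c j *: gamma ^+ j) = vp (c j).
Proof.
case: (@arg_maxP _ _ 'I_f (Ordinal f_gt0) xpredT (fun j => vp (c j)) isT) => d _ dmax'.
have dmax j : vp (c j) <= vp (c d) := dmax' j isT.
have le : v (\sum_j c j *: gamma ^+ j) <= vp (c d).
  by apply: nonarch_sum_le => [//|//|j _]; rewrite ?absv_ge0// ext_scale gammaX_abs mulr1.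
suff E : v (\sum_j c j *: gamma ^+ j) = vp (c d) by split=> [j|]; [rewrite E|exists d].
apply/eqP; rewrite eq_le le/=.
have [cd0|cd0] := eqVneq (c d) 0; first by rewrite cd0 absv0 absv_ge0.
have cdp : 0 < vp (c d) by rewrite absv_gt0.
pose c' j := (c d)^-1 * c j.
rewrite leNgt; apply/negP => lt.
suff : vp (c' d) < 1 by rewrite /c' mulVf// absv1 ltxx.
apply: gamma_residue_free => [j|].
  by rewrite absvM absvV mulrC ler_pdivrMr// mul1r.
under eq_bigr do rewrite -scalerA.
by rewrite -scaler_sumr ext_scale absvV mulrC ltr_pdivrMr// mul1r.
Qed.

Lemma beta_expe : v beta ^+ e = p%:R.
Proof.
rewrite beta_abs -powR_mulrn ?powR_ge0// -powRrM mulVf ?pnatr_eq0 -?lt0n//.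
by rewrite powRr1// ltW.
Qed.

Lemma beta_gt1 : 1 < v beta.
Proof.
rewrite ltNge; apply/negP => b1; have : v beta ^+ e <= 1 by rewrite exprn_ile1 ?absv_ge0.
by rewrite beta_expe leNgt p_gt1.
Qed.

Lemma beta_gt0 : 0 < v beta. Proof. exact: lt_trans beta_gt1. Qed.

Lemma beta_neq0 : beta != 0. Proof. by rewrite -(absv_gt0 v) beta_gt0. Qed.

Lemma base_value c : c != 0 -> exists z : int, vp c = v beta ^ (e%:Z * z).
Proof.
move=> c0; have [z ->] := padic_value p_prime Qp_padic c0.
by exists z; rewrite -exprz_exp -exprnP beta_expe.
Qed.

Definition gamma_comb (b : 'I_f -> Qp) : K := \sum_j b j *: gamma ^+ j.

Lemma basis_combE (b : 'I_e -> 'I_f -> Qp) :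
  basis_comb gamma beta b = \sum_i gamma_comb (b i) * beta ^+ i.
Proof.
rewrite /basis_comb; apply: eq_bigr => i _; rewrite mulr_suml.
by apply: eq_bigr => j _; rewrite scalerAl.
Qed.

Lemma gamma_comb_value b : gamma_comb b != 0 ->
  exists z : int, v (gamma_comb b) = v beta ^ (e%:Z * z).
Proof.
have [_ [j E]] := gamma_comb_abs b.
by rewrite -(absv_eq0b v) /gamma_comb E absv_eq0b => /base_value.
Qed.

(** The [i]-th term, if nonzero, has value [v beta] to a power congruent to [i] modulo [e], so
    distinct terms have distinct values and nothing cancels. *)
Lemma basis_term_le (b : 'I_e -> 'I_f -> Qp) i :
  v (gamma_comb (b i) * beta ^+ i) <= v (basis_comb gamma beta b).
Proof.
rewrite basis_combE; apply: (absv_le_sum_of_distinct na) => k l.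
rewrite mulf_eq0 negb_or => /andP[k0 _] E.
have l0 : gamma_comb (b l) != 0.
  rewrite -(absv_gt0 v) -(pmulr_lgt0 _ (_ : 0 < v beta ^+ l)) ?exprn_gt0 ?beta_gt0//.
  by rewrite -absvX -absvM -E absv_gt0 mulf_neq0// expf_neq0// beta_neq0.
have [z zE] := gamma_comb_value k0; have [w wE] := gamma_comb_value l0.
move: E; rewrite !absvM !absvX zE wE !exprnP -!expfzDr ?gt_eqF ?beta_gt0//.
move=> /(ieexprIz beta_gt0 (negbT (gt_eqF beta_gt1))) E.
apply/val_inj => /=; have := ltn_ord k; have := ltn_ord l.
by have [zw|wz|zw] := ltgtP z w; nia.
Qed.

Lemma basis_coef_le (b : 'I_e -> 'I_f -> Qp) i j :
  vp (b i j) * v beta ^+ i <= v (basis_comb gamma beta b).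
Proof.
apply: le_trans (basis_term_le b i); rewrite absvM absvX ler_pM2r ?exprn_gt0 ?beta_gt0//.
exact: (gamma_comb_abs (b i)).1.
Qed.

Lemma basis_exists x : exists b : 'I_e -> 'I_f -> Qp, x = basis_comb gamma beta b.
Proof.
apply: basis_comb_surj => // b b0 i j; apply/eqP; rewrite -(absv_eq0b vp).
have := basis_coef_le b i j; rewrite b0 absv0 pmulr_lle0 ?exprn_gt0 ?beta_gt0//.
by move=> h; rewrite eq_le h absv_ge0.
Qed.

(** By the ultrametric inequality some term of the basis expansion is as large as the sum, and
    nonzero terms have values of this shape. *)
Lemma ext_value x : x != 0 -> exists z : int, v x = v beta ^ z.
Proof.
have [b ->] := basis_exists x => x0.
have [i Ei] : exists i, v (basis_comb gamma beta b) = v (gamma_comb (b i) * beta ^+ i).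
  apply: contrapT => /forallNP H.
  suff : v (basis_comb gamma beta b) < v (basis_comb gamma beta b) by rewrite ltxx.
  rewrite {1}basis_combE; apply: nonarch_sum_lt; rewrite ?absv_gt0// => i _.
  by rewrite lt_neqAle basis_term_le andbT eq_sym; apply/eqP.
have g0 : gamma_comb (b i) != 0.
  by apply: contraNneq x0 => g0; rewrite -(absv_eq0b v) Ei g0 mul0r absv0.
have [z zE] := gamma_comb_value g0.
exists (e%:Z * z + i%:Z).
by rewrite Ei absvM absvX zE expfzDr ?gt_eqF ?beta_gt0.
Qed.

(** * Integral part and residue representatives in K *)

Local Notation floor := (cf_floor p vp e f gamma beta).

Lemma cf_floorP x : exists2 b : 'I_e -> 'I_f -> Qp, x = basis_comb gamma beta b &
  floor x = basis_comb gamma beta (fun i j => padic_floor p vp (b i j)).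
Proof.
rewrite /cf_floor; case: xgetP => [y _ [b xb yb]|H]; first by exists b.
have [b xb] := basis_exists x.
by have [] := H _ (ex_intro2 _ _ b xb erefl).
Qed.

Lemma basis_combB (b b' : 'I_e -> 'I_f -> Qp) : basis_comb gamma beta b - basis_comb gamma beta b' =
  basis_comb gamma beta (fun i j => b i j - b' i j).
Proof.
rewrite /basis_comb -sumrB; apply: eq_bigr => i _; rewrite -sumrB.
by apply: eq_bigr => j _; rewrite scalerBl.
Qed.

(** A coefficient of the remainder has absolute value below 1, hence at most [v beta] to the power
    -e; this outweighs the factor beta^i because i < e. *)
Lemma cf_floor_sub_lt1 x : v (x - floor x) < 1.
Proof.
have [b xb ->] := cf_floorP x; rewrite {}xb basis_combB.
apply: nonarch_sum_lt => // i _; apply: nonarch_sum_lt => // j _.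
rewrite ext_scale absvM !absvX gamma_abs expr1n mul1r.
have lt1 : vp (b i j - padic_floor p vp (b i j)) < 1 by exact: padic_floor_lt1.
have [->|b0] := eqVneq (b i j - padic_floor p vp (b i j)) 0.
  by rewrite absv0 mul0r.
move: lt1; have [z ->] := base_value b0.
rewrite -(expr0z (v beta)) ltr_eXz2l ?beta_gt1// => ez.
rewrite exprnP -expfzDr ?gt_eqF ?beta_gt0// ltr_eXz2l ?beta_gt1//.
by have := ltn_ord i; have [z0|z0] := ltP z 0; nia.
Qed.

(** Since [v beta] exceeds 1, each difference of coefficients is at most [v (x - x')], so the p-adic
    integral parts agree one by one. *)
Lemma cf_floor_eq x x' : v (x - x') < 1 -> floor x = floor x'.
Proof.
have [b xb ->] := cf_floorP x; have [b' xb' ->] := cf_floorP x'.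
rewrite xb xb' basis_combB => lt1; rewrite /basis_comb.
apply: eq_bigr => i _; apply: eq_bigr => j _; congr (_ *: _).
apply: padic_floor_eq => //; apply: le_lt_trans lt1.
apply: le_trans (basis_coef_le _ i j).
by rewrite ler_peMr ?absv_ge0// exprn_ege1// ltW// beta_gt1.
Qed.

(** The index type has p^f elements and is the source of the residue cardinality q = p^f. *)
Definition residue_rep (d : {ffun 'I_f -> 'I_p}) : K :=
  \sum_j (d j)%:R *: gamma ^+ j.

Lemma residue_rep_exists x : v x <= 1 -> exists d, v (x - residue_rep d) < 1.
Proof.
have [b ->] := basis_exists x => x1.
have b1 i j : vp (b i j) <= 1.
  apply: le_trans x1; apply: le_trans (basis_coef_le _ i j).
  by rewrite ler_peMr ?absv_ge0// exprn_ege1// ltW// beta_gt1.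
have dig j : exists y : 'I_p, vp (b (Ordinal e_gt0) j - y%:R) < 1.
  exact: padic_digit.
have [a ha] := choice dig; exists [ffun j => a j].
rewrite basis_combE (bigD1 (Ordinal e_gt0))//= expr0 mulr1 addrAC.
apply: nonarch_lt => //.
  rewrite -sumrB; apply: nonarch_sum_lt => // j _.
  by rewrite ffunE -scalerBl ext_scale gammaX_abs mulr1.
(* For 0 < i < e the exponent e z + i of [v beta] is never 0, so a value at most 1 is already below
   1: only the row i = 0 matters. *)
apply: nonarch_sum_lt => // i i0.
have [->|y0] := eqVneq (gamma_comb (b i)) 0; first by rewrite mul0r absv0.
have [z zE] := gamma_comb_value y0.
have := le_trans (basis_term_le b i) x1.
rewrite absvM absvX zE exprnP -expfzDr ?gt_eqF ?beta_gt0//.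
rewrite -(expr0z (v beta)) ler_eXz2l ?ltr_eXz2l ?beta_gt1//.
have : (0 < i)%N by rewrite lt0n; apply: contraNneq i0 => i0; apply/eqP/val_inj.
by have := ltn_ord i; have [z0|z0] := ltP z 0; nia.
Qed.

Lemma residue_rep_inj d d' : v (residue_rep d - residue_rep d') < 1 -> d = d'.
Proof.
rewrite /residue_rep -sumrB.
under eq_bigr do rewrite -scalerBl.
move=> /gamma_residue_free H.
have {}H j : vp ((d j)%:R - (d' j)%:R) < 1.
  apply: H => i; rewrite nonarch_le ?absvN ?(padic_nat_le1 p_prime)//.
  exact: padic_nonarch Qp_padic.
apply/ffunP => j; apply/val_inj => /=; move: (H j).
wlog le : d d' {H} / (d' j <= d j)%N.
  move=> W; case: (leqP (d' j) (d j)) => [|/ltnW] le; first exact: W.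
  by rewrite absvB => h; apply/esym/W.
rewrite -natrB// (padic_nat_lt1 p_prime)// => dv.
apply/eqP; rewrite eqn_leq le andbT -subn_eq0 -leqn0 leqNgt; apply/negP => gt0.
by have := dvdn_leq gt0 dv; rewrite leqNgt (leq_ltn_trans (leq_subr _ _) (ltn_ord _)).
Qed.

Lemma residue_rep_le1 d : v (residue_rep d) <= 1.
Proof.
apply: nonarch_sum_le => // j _.
by rewrite ext_scale gammaX_abs mulr1 (padic_nat_le1 p_prime).
Qed.

End LocalField.

(** * Second moments and almost sure limits *)

Section SecondMoment.
Context d (T : measurableType d) (R : realType) (P : probability T R).

Lemma expectation_big (I : Type) (s : seq I) (F : I -> T -> R) :
  (forall i, F i \in Lfun P 1%E) ->
  ('E_P[fun x => (\sum_(i <- s) F i x)%R] = \sum_(i <- s) 'E_P[F i])%E.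
Proof.
move=> F1; have -> : (fun x => (\sum_(i <- s) F i x)%R) = (\sum_(X <- map F s) X)%R.
  by apply/funext => x; rewrite big_map fct_sumE.
rewrite expectation_sum ?big_map// => X.
by elim: s => //= i s IH; rewrite inE => /orP[/eqP ->|/IH].
Qed.

Lemma window_count_le (k i n : nat) :
  (\sum_(j < n) ((i < j + k) && (j < i + k)) <= 2 * k)%N.
Proof.
rewrite -(big_mkord xpredT (fun j => nat_of_bool ((i < j + k) && (j < i + k))%N)).
rewrite -big_mkcond sum1_count -size_filter -(size_iota (i - k) (2 * k)).
apply: uniq_leq_size; first by rewrite filter_uniq// iota_uniq.
move=> j; rewrite mem_filter !mem_iota; lia.
Qed.

(** In the expanded square only pairs at distance less than [k] survive, at most 2k for each of the
    [n] first indices. *)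
Lemma second_moment_sum_le (X : nat -> T -> R) (n k : nat) (V : R) :
  (forall i, X i \in Lfun P 2%:E) ->
  (forall i j, ('E_P[X i \* X j] <= V%:E)%E) ->
  (forall i j, (i + k <= j)%N -> ('E_P[X i \* X j] = 0)%E) ->
  ('E_P[fun x => ((\sum_(i < n) X i x) ^+ 2)%R] <= (n%:R * (2 * k)%:R * V)%:E)%E.
Proof.
move=> X2 XV X0; have X12 i j : X i \* X j \in Lfun P 1%E by exact: Lfun2_mul_Lfun1.
have V0 : 0 <= V.
  rewrite -lee_fin; apply: le_trans (XV 0%N 0%N); apply: expectation_ge0 => x /=.
  by rewrite -expr2 sqr_ge0.
pose near_ i j := (i < j + k)%N && (j < i + k)%N.
have le i j : ('E_P[X i \* X j] <= ((near_ i j)%:R * V)%:E)%E.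
  rewrite /near_; case: ltnP => [ij|ji] /=; last first.
    by rewrite mul0r (_ : X i \* X j = X j \* X i)%R ?X0//; apply/funext => x; exact: mulrC.
  case: ltnP => [ji|ij'] /=; first by rewrite mul1r.
  by rewrite mul0r X0.
have -> : (fun x => (\sum_(i < n) X i x) ^+ 2) =
    (fun x => \sum_(p <- [seq (i, j) | i <- index_enum 'I_n, j <- index_enum 'I_n])
       (X p.1 \* X p.2)%R x)%R.
  apply/funext => x; rewrite big_allpairs expr2 mulr_suml.
  by apply: eq_bigr => i _; rewrite mulr_sumr.
rewrite (@expectation_big _ _ (fun p : 'I_n * 'I_n => X p.1 \* X p.2))//.
rewrite big_allpairs/=.
apply: (@le_trans _ _ (\sum_(i < n) (((2 * k)%:R * V)%:E))%E).
  apply: lee_sum => i _; apply: le_trans.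
    by apply: lee_sum => j _; exact: le.
  rewrite sumEFin lee_fin -mulr_suml ler_wpM2r// -natr_sum ler_nat.
  exact: window_count_le.
by rewrite sumEFin sumr_const card_ord lee_fin -[X in X <= _]mulr_natl mulrA.
Qed.

(** Fatou makes the lower limit of the squared deviations vanish almost everywhere; where [Z]
    converges to [l], this lower limit is (l - c)^2. *)
Lemma ae_limit_of_second_moment (Z : nat -> T -> R) (c C : R) :
  (forall n, measurable_fun setT (Z n)) ->
  (forall n, (0 < n)%N -> ('E_P[fun x => ((Z n x - c) ^+ 2)%R] <= (C / n%:R)%:E)%E) ->
  {ae P, forall x, cvgn (Z ^~ x)} ->
  {ae P, forall x, Z ^~ x @ \oo --> c}.
Proof.
move=> mZ EZ cvgZ.
pose f n x : \bar R := ((Z n x - c) ^+ 2)%:E.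
have mf n : measurable_fun setT (f n).
  by apply/measurable_EFinP; apply: measurable_funX; exact: measurable_funB.
have f0 n x : (0 <= f n x)%E by rewrite lee_fin sqr_ge0.
pose F x : \bar R := limn_einf (f^~ x).
have F0 x : (0 <= F x)%E.
  rewrite /F limn_einf_lim; apply: lime_ge; first exact: is_cvg_einfs.
  by apply: nearW => n; apply: le_ereal_inf_tmp => _ [m _ <-].
have mF : measurable_fun setT F.
  apply: (emeasurable_fun_cvg (fun n x => einfs (f^~ x) n)).
    by move=> n; exact: measurable_fun_einfs.
  by move=> x _; rewrite /F limn_einf_lim; exact: is_cvg_einfs.
have Ef_cvg : ((fun n => \int[P]_x f n x) @ \oo --> 0)%E.
  apply: (@squeeze_cvge _ _ _ _ (cst 0%E) _ (fun n => (C / n%:R)%:E)).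
  - exists 1%N => // n /= n0; rewrite integral_ge0//=.
    by have := EZ n n0; rewrite unlock.
  - exact: cvg_cst.
  - apply: cvg_EFin; first exact: nearW.
    rewrite -[X in _ --> X](mulr0 C); apply: cvgM; first exact: cvg_cst.
    apply/(@cvgrPdist_lt _ R^o) => eps eps0; exists (Num.bound eps^-1).+1 => // n /= Nn.
    have n0 : 0 < n%:R :> R by rewrite ltr0n (leq_trans _ Nn).
    rewrite sub0r normrN ger0_norm ?invr_ge0// invf_plt ?posrE//.
    apply: lt_trans (archi_boundP _) _; first by rewrite invr_ge0 ltW.
    by rewrite ltr_nat.
have intF : (\int[P]_x F x = 0)%E.
  apply/eqP; rewrite eq_le integral_ge0 ?andbT//.
  apply: le_trans (fatou _ _ _ _) _ => //.
  by rewrite (cvg_limn_einf_sup Ef_cvg).1.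
have aeF : {ae P, forall x, F x = 0%E}.
  have : ae_eq P setT F (cst 0%E).
    apply/ae_eq_integral_abs => //; rewrite -[RHS]intF.
    by apply: eq_integral => x _; rewrite gee0_abs.
  by apply: filterS => x /(_ I).
apply: filterS2 aeF cvgZ => x Fx /cvg_ex[l Zl].
suff lc : l = c by rewrite -lc.
have fl : (f ^~ x) @ \oo --> ((l - c) ^+ 2)%:E.
  apply: cvg_EFin; first exact: nearW.
  rewrite expr2 (_ : fine \o f^~ x = fun n => (Z n x - c) * (Z n x - c)).
    by apply: cvgM; apply: cvgB Zl _; exact: cvg_cst.
  by apply/funext => n; rewrite /= expr2.
move: Fx; rewrite /F (cvg_limn_einf_sup fl).1 => -[/eqP].
by rewrite sqrf_eq0 subr_eq0 => /eqP.
Qed.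

End SecondMoment.

(** * Sequences of independent digits *)

Definition prefix_set (s : seq nat) : set (nat -> nat) :=
  [set y | forall j, (j < size s)%N -> y j = nth 0%N s j].

(** The empty set is included for closure under intersection: of two prefixes, either one extends
    the other or they are incompatible. *)
Definition prefix_sets : set (set (nat -> nat)) :=
  [set A | A = set0 \/ exists s, A = prefix_set s].

Definition seq_space : Type := g_sigma_algebraType prefix_sets.
HB.instance Definition _ := Measurable.on seq_space.

Lemma prefix_set_nil : prefix_set [::] = setT.
Proof. by apply/seteqP; split. Qed.

Lemma prefix_sets_setI : setI_closed prefix_sets.
Proof.
move=> _ _ [->|[s ->]] [->|[t ->]]; rewrite ?set0I ?setI0; try by left.
wlog st : s t / (size s <= size t)%N.
  by move=> H; case: (leqP (size s) (size t)) => [|/ltnW] st; [exact: H|rewrite setIC; exact: H].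
have [E|NE] := pselect (forall j, (j < size s)%N -> nth 0%N t j = nth 0%N s j).
  right; exists t; apply/seteqP; split=> [y [] //|y yt]; split=> // j js.
  by rewrite yt ?E// (leq_trans js).
left; apply/seteqP; split=> // y [ys yt]; apply: NE => j js.
by rewrite -yt ?ys// (leq_trans js).
Qed.

Lemma prefix_set_measurable s : measurable (prefix_set s : set seq_space).
Proof. by apply: sub_sigma_algebra; right; exists s. Qed.

Definition prefix_of (k : nat) (y : nat -> nat) : k.-tuple nat := [tuple y i | i < k].

Lemma prefix_setP k (t : k.-tuple nat) y : prefix_set t y <-> prefix_of k y = t.
Proof.
split=> [H|<- j]; last first.
  by rewrite size_tuple => jk; rewrite -(tnth_nth 0%N _ (Ordinal jk)) tnth_mktuple.
apply: eq_from_tnth => i; rewrite tnth_mktuple (tnth_nth 0%N); apply: H.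
by rewrite size_tuple.
Qed.

Definition seq_shift (k : nat) (y : seq_space) : seq_space := fun n => y (k + n)%N.

Lemma iter_seq_shift k y : iter k (seq_shift 1) y = seq_shift k y.
Proof.
elim: k => [|k IH] /=; first by apply/funext.
by rewrite IH; apply/funext => n; rewrite /seq_shift addnCA addnA add1n.
Qed.

Lemma prefix_set_cat s t :
  prefix_set s `&` seq_shift (size s) @^-1` prefix_set t = prefix_set (s ++ t).
Proof.
apply/seteqP; split=> [y [ys yt] j|y H].
  rewrite size_cat nth_cat; case: (ltnP j (size s)) => [js _|sj jst]; first exact: (ys j js).
  by rewrite -(yt (j - size s)%N) ?ltn_subLR// /seq_shift subnKC.
split=> [j js|j jt]; first by rewrite H ?nth_cat ?js// size_cat ltn_addr.
by rewrite /seq_shift H ?size_cat ?ltn_add2l// nth_cat ltnNge leq_addr/= addKn.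
Qed.

Lemma bigcup_prefix_set k (Q : k.-tuple nat -> Prop) :
  [set y : seq_space | Q (prefix_of k y)] =
  \bigcup_(t : k.-tuple nat) (if `[< Q t >] then prefix_set t else set0).
Proof.
apply/seteqP; split=> y.
  move=> Qy; exists (prefix_of k y) => //; rewrite ifT; first exact/prefix_setP.
  exact/asboolP.
by move=> [t _]; case: asboolP => // Qt /prefix_setP; rewrite /= => ->.
Qed.

Lemma prefix_event_measurable k (Q : k.-tuple nat -> Prop) :
  measurable [set y : seq_space | Q (prefix_of k y)].
Proof.
rewrite bigcup_prefix_set; apply: countable_bigcupT_measurable => // t.
by case: ifP => // _; exact: prefix_set_measurable.
Qed.

Lemma prefix_fun_measurable k d (U : measurableType d) (G : k.-tuple nat -> U) :
  measurable_fun setT (fun y : seq_space => G (prefix_of k y)).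
Proof.
by move=> _ A mA; rewrite setTI; exact: (prefix_event_measurable (fun t => A (G t))).
Qed.

(** The preimage of a prefix set is decided by the first [k + size s] coordinates. *)
Lemma seq_shift_measurable k : measurable_fun setT (seq_shift k).
Proof.
apply: (@measurability _ _ seq_space seq_space setT (seq_shift k) prefix_sets)
  => // _ [_ [->|[s ->]] <-].
  by rewrite preimage_set0 setI0.
rewrite setTI (_ : _ @^-1` _ = [set y : seq_space | forall j, (j < size s)%N ->
  nth 0%N (prefix_of (k + size s) y) (k + j) = nth 0%N s j]).
  exact: (prefix_event_measurable (fun t : (k + size s).-tuple nat =>
    forall j, (j < size s)%N -> nth 0%N t (k + j) = nth 0%N s j)).
have E y j (js : (k + j < k + size s)%N) : nth 0%N (prefix_of (k + size s) y) (k + j) = y (k + j)%N.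
  by rewrite -(tnth_nth 0%N _ (Ordinal js)) tnth_mktuple.
apply/seteqP; split=> y H j js.
  by rewrite E ?ltn_add2l//; exact: H.
by have := H j js; rewrite E ?ltn_add2l.
Qed.

(** Bundles the pushforward as a measure, for use in uniqueness statements and changes of
    measure. *)
Definition seq_shift_measure (R : realType) (m : {measure set seq_space -> \bar R}) (k : nat) :
  {measure set seq_space -> \bar R}.
Proof.
by unshelve refine (pushforward m (seq_shift k) : {measure set seq_space -> \bar R});
  exact: seq_shift_measurable.
Defined.

Section ProductMeasure.
Variables (R : realType) (nu : probability seq_space R) (w : nat -> R).
Hypothesis nu_prefix : forall s, nu (prefix_set s) = (\prod_(i <- s) w i)%:E.

Lemma seq_measure_unique (m1 m2 : {measure set seq_space -> \bar R}) :
  (m1 setT < +oo)%E -> (forall s, m1 (prefix_set s) = m2 (prefix_set s)) ->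
  forall A, measurable A -> m1 A = m2 A.
Proof.
move=> m1oo E A mA.
apply: (@g_sigma_algebra_measure_unique _ R seq_space prefix_sets _ (fun=> setT)) => //.
- by move=> B GB; exact: sub_sigma_algebra.
- by move=> _; right; exists [::]; rewrite prefix_set_nil.
- by rewrite bigcup_const//; exists 0%N.
- exact: prefix_sets_setI.
- by move=> B [->|[s ->]]; rewrite ?measure0.
Qed.

Let w_prod_ge0 s : 0 <= \prod_(i <- s) w i.
Proof. by rewrite -lee_fin -nu_prefix. Qed.

(** As functions of [A], both sides are finite measures; they agree on prefix sets because prefixes
    concatenate. *)
Lemma prefix_set_indep s A : measurable A ->
  (nu (seq_shift (size s) @^-1` A `&` prefix_set s) = (\prod_(i <- s) w i)%:E * nu A)%E.
Proof.
move=> mA; have mD := prefix_set_measurable s.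
apply: (@seq_measure_unique (seq_shift_measure (mrestr nu mD) (size s))
  (mscale (NngNum (w_prod_ge0 s)) nu)) => // [|t].
  by rewrite /= /pushforward /mrestr preimage_setT setTI nu_prefix ltry.
rewrite /= /pushforward /mrestr /mscale/= setIC prefix_set_cat !nu_prefix big_cat/=.
by rewrite EFinM.
Qed.

(** Splitting according to the first coordinate gives the measure of [A] times the sum of the
    weights; the case of the whole space shows that this sum is 1. *)
Lemma seq_shift1_preserving A : measurable A -> nu (seq_shift 1 @^-1` A) = nu A.
Proof.
have H B : measurable B -> nu (seq_shift 1 @^-1` B) =
    (\sum_(0 <= i <oo | i \in [set: nat]) (w i)%:E * nu B)%E.
  move=> mB; have mSB : measurable (seq_shift 1 @^-1` B).
    by rewrite -[X in measurable X]setTI; exact: seq_shift_measurable.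
  transitivity (nu (\bigcup_i (seq_shift 1 @^-1` B `&` prefix_set [:: i]))).
    congr (nu _); rewrite -setI_bigcupr (_ : \bigcup_i _ = setT) ?setIT//.
    by apply/seteqP; split=> // y _; exists (y 0%N) => // -[].
  transitivity (\sum_(0 <= i <oo | i \in [set: nat])
      nu (seq_shift 1 @^-1` B `&` prefix_set [:: i]))%E.
    apply: measure_bigcup => [i _|i j _ _ [y [[_ yi] [_ yj]]]].
      by apply: measurableI => //; exact: prefix_set_measurable.
    by rewrite -[i](yi 0%N isT) -[j](yj 0%N isT).
  by apply: eq_eseriesr => i _; have := @prefix_set_indep [:: i] B mB; rewrite big_seq1.
move=> mA; rewrite H//.
have w0 i : (0 <= (w i)%:E)%E by have := w_prod_ge0 [:: i]; rewrite big_seq1 lee_fin.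
have w1 : (\sum_(0 <= i <oo | i \in [set: nat]) (w i)%:E = 1)%E.
  transitivity (nu (seq_shift 1 @^-1` setT)); last by rewrite preimage_setT probability_setT.
  by rewrite H//; apply: eq_eseriesr => i _; rewrite probability_setT mule1.
under eq_eseriesr do rewrite muleC.
have nuA : nu A \is a fin_num by exact: fin_num_measure.
rewrite -(fineK nuA) nneseriesZl ?w1 ?mule1//.
Qed.

Lemma seq_shift_preserving k A : measurable A -> nu (seq_shift k @^-1` A) = nu A.
Proof.
elim: k A => [|k IH] A mA.
  by congr (nu _); apply/seteqP; split=> y.
have mSA : measurable (seq_shift k @^-1` A).
  by rewrite -[X in measurable X]setTI; exact: seq_shift_measurable.
rewrite -(IH A mA) -(seq_shift1_preserving mSA); congr (nu _).
Qed.

Lemma ge0_integral_seq_shift k (f : seq_space -> \bar R) :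
  measurable_fun setT f -> (forall y, 0 <= f y)%E ->
  (\int[nu]_y f (seq_shift k y) = \int[nu]_y f y)%E.
Proof.
move=> mf f0; transitivity (\int[pushforward nu (seq_shift k)]_y f y)%E.
  by rewrite (ge0_integral_pushforward (seq_shift_measurable k))//= preimage_setT.
apply: (@eq_measure_integral _ _ _ _ nu (seq_shift_measure nu k)) => A mA _.
exact: seq_shift_preserving.
Qed.

(** Integrated form of [prefix_set_indep]: the restriction of [nu] to the prefix set, pushed by the
    shift, is a multiple of [nu]. *)
Lemma ge0_integral_prefix_shift s (f : seq_space -> \bar R) :
  measurable_fun setT f -> (forall y, 0 <= f y)%E ->
  (\int[nu]_(y in prefix_set s) f (seq_shift (size s) y) =
   (\prod_(i <- s) w i)%:E * \int[nu]_y f y)%E.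
Proof.
move=> mf f0; have mD := prefix_set_measurable s.
have mfS : measurable_fun setT (f \o seq_shift (size s)).
  by apply: measurableT_comp => //; exact: seq_shift_measurable.
rewrite -(@ge0_integral_mscale _ _ _ nu setT measurableT (NngNum (w_prod_ge0 s)))//.
transitivity (\int[pushforward (mrestr nu mD) (seq_shift (size s))]_y f y)%E; last first.
  apply: (@eq_measure_integral _ _ _ _ (mscale (NngNum (w_prod_ge0 s)) nu)
    (seq_shift_measure (mrestr nu mD) (size s))) => A mA _.
  exact: prefix_set_indep.
rewrite (ge0_integral_pushforward (seq_shift_measurable (size s)))//= preimage_setT.
rewrite (@ge0_negligible_integral _ _ _ (mrestr nu mD) setT (~` prefix_set s))//.
- rewrite setTD setCK; apply: eq_measure_integral => A mA AD.
  have E : A `&` prefix_set s = A by apply/setIidl.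
  by first [exact: (congr1 nu E)|exact: (esym (congr1 nu E))].
- exact: measurableC.
- by transitivity (nu set0); [congr (nu _); exact: setICl|exact: measure0].
Qed.

End ProductMeasure.

(** Enumerates the prefix sets of length [k] by natural numbers, as countable additivity of the
    integral expects; numbers that code no tuple give the empty piece. *)
Definition prefix_piece (k n : nat) : set seq_space :=
  if (pickle_inv n : option (k.-tuple nat)) is Some t then prefix_set t else set0.

Lemma prefix_piece_cover k : \bigcup_n prefix_piece k n = setT.
Proof.
apply/seteqP; split=> // y _; exists (pickle (prefix_of k y)) => //.
by rewrite /prefix_piece pickleK_inv; apply/prefix_setP.
Qed.

Lemma prefix_piece_measurable k n : measurable (prefix_piece k n).
Proof.
by rewrite /prefix_piece; case: pickle_inv => // t; exact: prefix_set_measurable.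
Qed.

Lemma prefix_piece_trivIset k : trivIset setT (prefix_piece k).
Proof.
move=> i j _ _ [y []]; rewrite /prefix_piece.
have inv n : oapp pickle n (pickle_inv n : option (k.-tuple nat)) = n.
  exact: pickle_invK.
have := inv i; have := inv j.
case: (pickle_inv i) => //= t; case: (pickle_inv j) => //= t' <- <-.
by move=> /prefix_setP <- /prefix_setP <-.
Qed.

(** * Decorrelation of shifted functions and their averages *)

Section SequenceErgodic.
Variables (R : realType) (nu : probability seq_space R) (w : nat -> R).
Hypothesis nu_prefix : forall s, nu (prefix_set s) = (\prod_(i <- s) w i)%:E.

Lemma Lfun2_of_sqr (f : seq_space -> R) : measurable_fun setT f ->
  (\int[nu]_y (f y ^+ 2)%:E < +oo)%E -> f \in Lfun nu 2%:E.
Proof.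
move=> mf foo; rewrite inE; apply/andP; split; rewrite inE//= /finite_norm.
rewrite unlock; apply: poweR_lty; apply: le_lt_trans foo.
rewrite le_eqVlt; apply/orP; left; apply/eqP; apply: eq_integral => y _.
by rewrite /= powR_mulrn// -normrX ger0_norm// sqr_ge0.
Qed.

Lemma integrable_seq_shift k (h : seq_space -> R) :
  nu.-integrable setT (EFin \o h) -> nu.-integrable setT (fun y => (h (seq_shift k y))%:E).
Proof.
move=> /integrableP[mh hoo]; apply/integrableP; split.
  by apply: (measurableT_comp mh); exact: seq_shift_measurable.
by rewrite (@ge0_integral_seq_shift _ _ _ nu_prefix k (fun y => `|(h y)%:E|%E))//;
  apply: measurableT_comp mh.
Qed.

(** The positive and negative parts of [h] have equal finite integrals, and independence multiplies
    both by the same weight. *)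
Lemma integral_prefix_shift0 s (h : seq_space -> R) :
  nu.-integrable setT (EFin \o h) -> (\int[nu]_y (h y)%:E = 0)%E ->
  (\int[nu]_(y in prefix_set s) (h (seq_shift (size s) y))%:E = 0)%E.
Proof.
move=> ih h0; have /integrableP[mh _] := ih.
have finp := integrable_pos_fin_num measurableT ih.
have finn := integrable_neg_fin_num measurableT ih.
have E : (\int[nu]_y (EFin \o h)^\- y = \int[nu]_y (EFin \o h)^\+ y)%E.
  have : (\int[nu]_y (EFin \o h)^\+ y - \int[nu]_y (EFin \o h)^\- y = 0)%E.
    by rewrite -h0 [RHS]integralE.
  rewrite -(fineK finp) -(fineK finn) => -[/eqP].
  by rewrite subr_eq0 => /eqP ->.
rewrite integralE.
rewrite [X in (X - _)%E](_ : _ =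
    ((\prod_(i <- s) w i)%:E * \int[nu]_y (EFin \o h)^\+ y)%E); last first.
  rewrite -(ge0_integral_prefix_shift nu_prefix s (f := (EFin \o h)^\+)%E)//.
    by apply: eq_integral => y _; rewrite !funeposE.
  exact: measurable_funepos.
rewrite [X in (_ - X)%E](_ : _ =
    ((\prod_(i <- s) w i)%:E * \int[nu]_y (EFin \o h)^\- y)%E); last first.
  rewrite -(ge0_integral_prefix_shift nu_prefix s (f := (EFin \o h)^\-)%E)//.
    by apply: eq_integral => y _; rewrite !funenegE.
  exact: measurable_funeneg.
by rewrite E subee// fin_numM.
Qed.

(** On each prefix set of length [k] the factor [G] is constant, and the remaining centred factor
    integrates to 0 there. *)
Lemma integral_prefix_fun_shift0 k (G : k.-tuple nat -> R) (h : seq_space -> R) :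
  nu.-integrable setT (EFin \o h) -> (\int[nu]_y (h y)%:E = 0)%E ->
  nu.-integrable setT (fun y => (G (prefix_of k y) * h (seq_shift k y))%:E) ->
  (\int[nu]_y (G (prefix_of k y) * h (seq_shift k y))%:E = 0)%E.
Proof.
move=> ih h0 iGh.
rewrite -(prefix_piece_cover k) integral_bigcup ?prefix_piece_cover//; last 2 first.
- exact: prefix_piece_trivIset.
- exact: prefix_piece_measurable.
apply: eseries0 => n _ _; rewrite /prefix_piece.
case: pickle_inv => [t|]; last by rewrite integral_set0.
rewrite (eq_integral (fun y => (G t)%:E * (h (seq_shift k y))%:E)%E); last first.
  by move=> y /set_mem /prefix_setP ->; rewrite EFinM.
rewrite integralZl//; last 2 first.
- exact: prefix_set_measurable.
- apply: integrableS (integrable_seq_shift k ih) => //; exact: prefix_set_measurable.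
by have := integral_prefix_shift0 t ih h0; rewrite size_tuple => ->; rewrite mule0.
Qed.

Lemma integral_seq_shift0 k (h : seq_space -> R) :
  nu.-integrable setT (EFin \o h) -> (\int[nu]_y (h y)%:E = 0)%E ->
  (\int[nu]_y (h (seq_shift k y))%:E = 0)%E.
Proof.
move=> ih h0; have E : (fun y => (1 * h (seq_shift k y))%:E) = (fun y => (h (seq_shift k y))%:E).
  by apply/funext => y; rewrite mul1r.
have := @integral_prefix_fun_shift0 k (fun=> 1) h ih h0; rewrite /= E; apply.
exact: integrable_seq_shift.
Qed.

Section Centered.
Variables (k : nat) (G : k.-tuple nat -> R) (h : seq_space -> R).
Hypothesis hG : forall y, h y = G (prefix_of k y).
Hypothesis h2 : h \in Lfun nu 2%:E.
Hypothesis h0 : (\int[nu]_y (h y)%:E = 0)%E.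

Let V := fine (\int[nu]_y (h y ^+ 2)%:E).

Let mh : measurable_fun setT h.
Proof. by move: h2; rewrite inE => /andP[]; rewrite inE. Qed.

Let h_sqr : nu.-integrable setT (EFin \o (fun x => h x ^+ 2)).
Proof. exact: Lfun2_integrable_sqr. Qed.

Let VE : (\int[nu]_y (h y ^+ 2)%:E)%E = V%:E.
Proof. by rewrite /V fineK// (integrable_fin_num measurableT h_sqr). Qed.

Let ih : nu.-integrable setT (EFin \o h).
Proof.
have fin : nu [set: seq_space] \is a fin_num by rewrite probability_setT.
by apply/Lfun1_integrable; apply: (Lfun_subset12 fin).
Qed.

Let integral_shift_sqr p : (\int[nu]_y (h (seq_shift p y) ^+ 2)%:E)%E = V%:E.
Proof.
rewrite -VE (ge0_integral_seq_shift nu_prefix p (f := fun y => (h y ^+ 2)%:E))//.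
  by apply/measurable_EFinP; exact: measurable_funX.
by move=> y; rewrite lee_fin sqr_ge0.
Qed.

Let mh_shift p : measurable_fun setT (h \o seq_shift p).
Proof. by apply: measurableT_comp mh _; exact: seq_shift_measurable. Qed.

Lemma shift_Lfun2 p : h \o seq_shift p \in Lfun nu 2%:E.
Proof. by apply: Lfun2_of_sqr => //; rewrite /= integral_shift_sqr ltry. Qed.

Let iM p q : nu.-integrable setT (EFin \o ((h \o seq_shift p) \* (h \o seq_shift q))).
Proof. by apply/Lfun1_integrable; apply: Lfun2_mul_Lfun1; exact: shift_Lfun2. Qed.

(** Uses xy <= (x^2 + y^2)/2 and the shift invariance of the second moment. *)
Lemma shift_product_le p q :
  ('E_nu[(h \o seq_shift p) \* (h \o seq_shift q)] <= V%:E)%E.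
Proof.
rewrite unlock.
have E r : EFin \o (fun y => h (seq_shift r y) ^+ 2 / 2) =
    (fun y => (2^-1)%:E * (EFin \o (fun y => ((h \o seq_shift r) y ^+ 2)%R)) y)%E.
  by apply/funext => y; rewrite /= -EFinM mulrC.
have is2 r := @Lfun2_integrable_sqr _ _ _ _ _ (shift_Lfun2 r).
have i2 r : nu.-integrable setT (EFin \o (fun y => h (seq_shift r y) ^+ 2 / 2)).
  by rewrite E; exact: integrableZl.
have iV r : (\int[nu]_y (EFin \o (fun y => (h (seq_shift r y) ^+ 2 / 2)%R)) y)%E = (V / 2)%:E.
  rewrite E; transitivity ((2^-1)%:E * \int[nu]_y (h (seq_shift r y) ^+ 2)%:E)%E.
    exact: integralZl.
  by rewrite integral_shift_sqr -EFinM mulrC.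
have -> : V%:E = (\int[nu]_y ((EFin \o (fun y => (h (seq_shift p y) ^+ 2 / 2)%R)) y +
    (EFin \o (fun y => (h (seq_shift q y) ^+ 2 / 2)%R)) y))%E.
  by rewrite integralD// !iV -EFinD -splitr.
apply: le_integral; [exact: measurableT|exact: iM|exact: (integrableD measurableT (i2 p) (i2 q))|].
move=> y _; rewrite lee_fin /=.
have := sqr_ge0 (h (seq_shift p y) - h (seq_shift q y)); nra.
Qed.

Lemma shift_product_eq0 p q : (p + k <= q)%N ->
  ('E_nu[(h \o seq_shift p) \* (h \o seq_shift q)] = 0)%E.
Proof.
move=> pq; rewrite unlock.
(* The common shift by [p] is factored out; what is left is a function of the first [k] coordinates
   times a function of the later ones. *)
pose g y := G (prefix_of k y) * h (seq_shift (q - p - k) (seq_shift k y)).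
have E y : ((h \o seq_shift p) \* (h \o seq_shift q)) y = g (seq_shift p y).
  rewrite /g /= -hG; congr (_ * h _); apply/funext => n; rewrite /seq_shift.
  by congr (y _); lia.
have ig : nu.-integrable setT (EFin \o g).
  have -> : g = (h \o seq_shift 0) \* (h \o seq_shift (q - p)).
    apply/funext => y; rewrite /g /= -hG; congr (h _ * h _).
    by apply/funext => n; rewrite /seq_shift; congr (y _); lia.
  exact: iM.
under eq_integral do rewrite E.
apply: integral_seq_shift0 => //.
apply: (integral_prefix_fun_shift0 (h := h \o seq_shift (q - p - k))) => //.
  exact: integrable_seq_shift.
exact: integral_seq_shift0.
Qed.

End Centered.

(** Transfers the distance between indices to the shifts [a j]: terms at least [k] apart in the
    average are uncorrelated. *)
Lemma increasing_gap (a : nat -> nat) : strictly_increasing_pos a ->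
  forall m n, (1 <= m)%N -> (m <= n)%N -> (a m + (n - m) <= a n)%N.
Proof.
move=> [_ inc] m n m1; elim: n => [|n IH]; first by rewrite leqNgt m1.
rewrite leq_eqVlt => /orP[/eqP -> |]; first by rewrite subnn addn0.
rewrite ltnS => mn; rewrite subSn// addnS.
by apply: leq_ltn_trans (IH mn) _; apply: inc => //; exact: leq_trans m1 mn.
Qed.

Lemma seq_average_limit k (G : k.-tuple nat -> R) (a : nat -> nat) :
  L2_good_universal R a ->
  (\int[nu]_y (G (prefix_of k y) ^+ 2)%:E < +oo)%E ->
  {ae nu, forall y, (fun n : nat => n%:R^-1 * \sum_(1 <= j < n.+1)
      G (prefix_of k (seq_shift (a j - 1) y))) @ \oo -->
    fine (\int[nu]_y (G (prefix_of k y))%:E)}.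
Proof.
move=> [a_inc a_good] G2.
pose g (y : seq_space) := G (prefix_of k y).
have mg : measurable_fun setT g by exact: prefix_fun_measurable.
have g2 : g \in Lfun nu 2%:E by exact: Lfun2_of_sqr.
have fin : nu [set: seq_space] \is a fin_num by rewrite probability_setT.
have ig : nu.-integrable setT (EFin \o g).
  by apply/Lfun1_integrable; apply: (Lfun_subset12 fin).
pose c := fine (\int[nu]_y (g y)%:E).
have cE : (\int[nu]_y (g y)%:E)%E = c%:E.
  by rewrite /c fineK// (integrable_fin_num measurableT ig).
pose h (y : seq_space) := g y - c.
have h2 : h \in Lfun nu 2%:E.
  have -> : h = g - cst c by [].
  have cL : cst c \in Lfun nu 2%:E := @Lfun_cst _ _ _ nu c 2.
  by apply: rpredB => //; rewrite lee_fin ler1n.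
have h0 : (\int[nu]_y (h y)%:E = 0)%E.
  transitivity (\int[nu]_y ((EFin \o g) y - (EFin \o cst c) y))%E.
    by apply: eq_integral => y _; rewrite /h EFinB.
  have ic : (\int[nu]_y (EFin \o cst c) y = c%:E)%E.
    transitivity (c%:E * nu [set: seq_space])%E.
      exact: (@integral_cst _ _ R nu setT measurableT c%:E).
    by rewrite probability_setT mule1.
  have inc : nu.-integrable setT (EFin \o cst c) := finite_measure_integrable_cst nu c measurableT.
  transitivity (\int[nu]_y (EFin \o g) y - \int[nu]_y (EFin \o cst c) y)%E.
    exact: integralB.
  by rewrite ic cE subee.
have hG y : h y = (fun t => G t - c) (prefix_of k y) by [].
pose V := fine (\int[nu]_y (h y ^+ 2)%:E).
(* [X] is indexed from 0 and the average from 1, whence [a i.+1]; the exponent [a j - 1] is that of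
   the good universal averages. *)
pose X i : seq_space -> R := h \o seq_shift (a i.+1 - 1).
have X2 i : X i \in Lfun nu 2%:E by exact: shift_Lfun2.
have XV i j : ('E_nu[X i \* X j] <= V%:E)%E by exact: shift_product_le.
have X0 i j : (i + k <= j)%N -> ('E_nu[X i \* X j] = 0)%E.
  move=> ij; apply: (shift_product_eq0 (k := k) (G := fun t => G t - c) hG) => //.
  have le_ij : (i < j.+1)%N by rewrite ltnS (leq_trans (leq_addr k i)).
  have := increasing_gap a_inc (ltn0Sn i) le_ij; have := a_inc.1 i.+1 (ltn0Sn i); lia.
pose Z (n : nat) (y : seq_space) :=
  n%:R^-1 * \sum_(1 <= j < n.+1) g (seq_shift (a j - 1) y).
have ZX n y : (0 < n)%N -> Z n y - c = n%:R^-1 * \sum_(i < n) X i y.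
  move=> n0; have nR : n%:R != 0 :> R by rewrite pnatr_eq0 -lt0n.
  rewrite /Z big_add1 /= big_mkord /X /h /= sumrB mulrBr; congr (_ - _).
  by rewrite sumr_const card_ord -[c *+ n]mulr_natl mulKf.
(* The constant is the bound n (2k) V on the second moment of the sum, divided by n^2 and freed of
   1/n. *)
apply: (@ae_limit_of_second_moment _ _ _ nu Z c ((2 * k)%:R * V)).
- move=> n; apply: measurable_funM => //; apply: measurable_sum => j.
  by apply: measurableT_comp mg _; exact: seq_shift_measurable.
- move=> n n0; have nR : n%:R != 0 :> R by rewrite pnatr_eq0 -lt0n.
  have mS : measurable_fun setT (fun y => (\sum_(i < n) X i y) ^+ 2).
    apply: measurable_funX; apply: measurable_sum => i.
    by move: (X2 i); rewrite inE => /andP[]; rewrite inE.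
  have S2 := second_moment_sum_le n X2 XV X0.
  rewrite unlock in S2 *.
  apply: (@le_trans _ _ ((n%:R ^- 2)%:E * \int[nu]_y ((\sum_(i < n) X i y) ^+ 2)%:E)%E).
    rewrite -ge0_integralZl; last 4 first.
    + exact: measurableT.
    + exact/measurable_EFinP.
    + by move=> y _; rewrite lee_fin sqr_ge0.
    + by rewrite lee_fin invr_ge0 exprn_ge0.
    rewrite le_eqVlt; apply/orP; left; apply/eqP; apply: eq_integral => y _.
    by rewrite ZX//= exprMn exprVn EFinM.
  apply: (@le_trans _ _ ((n%:R ^- 2)%:E * (n%:R * (2 * k)%:R * V)%:E)%E).
    by apply: lee_wpmul2l S2; rewrite lee_fin invr_ge0 exprn_ge0.
  rewrite -EFinM lee_fin le_eqVlt; apply/orP; left; apply/eqP; field.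
  exact: nR.
(* Good universality enters here: it supplies the existence of the almost sure limit. *)
- have mp : measure_preserving nu (seq_shift 1).
    by split; [exact: seq_shift_measurable|move=> A mA; exact: seq_shift_preserving].
  apply: filterS (a_good _ _ nu (seq_shift 1) mp g g2) => y.
  rewrite (_ : (fun n => _) = Z ^~ y)//; apply/funext => n; congr (_ * _).
  by apply: eq_bigr => j _; rewrite iter_seq_shift.
Qed.

End SequenceErgodic.

(** * Integrals of functions of finitely many coordinates as sums *)

Section PrefixSums.
Variables (R : realType) (nu : probability seq_space R) (w : nat -> R).
Hypothesis nu_prefix : forall s, nu (prefix_set s) = (\prod_(i <- s) w i)%:E.

Lemma ge0_integral_prefix_esum k (g : k.-tuple nat -> \bar R) :
  (forall t, 0 <= g t)%E ->
  (\int[nu]_y g (prefix_of k y) =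
   \esum_(t in [set: k.-tuple nat]) (g t * (\prod_(i <- t) w i)%:E))%E.
Proof.
move=> g0; have w0 s : 0 <= \prod_(i <- s) w i by rewrite -lee_fin -nu_prefix.
rewrite -(prefix_piece_cover k) ge0_integral_bigcup//; last 3 first.
- exact: prefix_piece_measurable.
- by apply: measurable_funTS; exact: prefix_fun_measurable.
- exact: prefix_piece_trivIset.
pose a (n : nat) : \bar R := if (pickle_inv n : option (k.-tuple nat)) is Some t
  then (g t * (\prod_(i <- t) w i)%:E)%E else 0%E.
have a0 n : (0 <= a n)%E.
  by rewrite /a; case: pickle_inv => // t; rewrite mule_ge0 ?lee_fin.
rewrite (eq_eseriesr (g := a)); last first.
  move=> n _; rewrite /prefix_piece /a; case: pickle_inv => [t|]; last by rewrite integral_set0.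
  rewrite (eq_integral (fun=> g t)); last by move=> y /set_mem /prefix_setP ->.
  transitivity (g t * nu (prefix_set t))%E; last by rewrite nu_prefix.
  exact: (@integral_cst _ _ R nu _ (prefix_set_measurable t)).
(* The series over natural numbers is cut down to the codes of tuples, the others contributing 0,
   and then reindexed by tuples. *)
rewrite nneseries_esumT// (esumID (range (pickle : k.-tuple nat -> nat)))// setTI setTI.
rewrite [X in (_ + X)%E]esum1 ?adde0; last first.
  move=> n nr; rewrite /a.
  have := pickle_invK (T := k.-tuple nat) n; case: pickle_inv => //= t tn.
  by case: nr; exists t.
rewrite esum_image; last by move=> t t' _ _; apply: (pcan_inj pickleK).
by apply: eq_esum => t _; rewrite /a pickleK_inv.
Qed.

(** The integral of a nonnegative function is a supremum over simple functions below it, so the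
    comparison applies directly to the integrand built from an arbitrary [H] on the whole ball. *)
Lemma integral_mono_patch d (T : measurableType d) (mu : {measure set T -> \bar R})
  (D E : set T) (f g : T -> \bar R) :
  (forall x, D x -> 0 <= f x)%E -> (forall x, E x -> 0 <= g x)%E ->
  (forall x, (f \_ D) x <= (g \_ E) x)%E ->
  (\int[mu]_(x in D) f x <= \int[mu]_(x in E) g x)%E.
Proof.
move=> f0 g0 fg; rewrite !ge0_integralE//; apply: ereal_sup_le => _ [h hf <-].
by exists h => // x; apply: le_trans (fg x).
Qed.

Lemma sum_over_prefix k (G : k.-tuple nat -> R) (I : choiceType) (D : set I) (h : I -> R)
    (code : k.-tuple nat -> I) :
  set_bij setT D code -> (forall t, h (code t) = G t * \prod_(i <- t) w i) ->
  nu.-integrable setT (fun y => (G (prefix_of k y))%:E) ->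
  summable D (EFin \o h) /\
  sum_over D h = fine (\int[nu]_y (G (prefix_of k y))%:E).
Proof.
move=> bij hG /integrableP[mG Goo].
have w0 s : 0 <= \prod_(i <- s) w i by rewrite -lee_fin -nu_prefix.
split.
  rewrite /summable (@reindex_esum R _ _ setT D code _ bij); apply: le_lt_trans Goo.
  rewrite (@ge0_integral_prefix_esum k (fun t => `|(G t)%:E|%E))//.
  by apply: le_esum => t _; rewrite /= hG normrM (ger0_norm (w0 _)) EFinM.
(* [s] will be the positive part and then the negative part, both compatible with multiplication by
   the nonnegative weights. *)
have E (s : R -> \bar R) : (forall x, 0 <= s x)%E ->
    (forall x c, 0 <= c -> s (x * c) = (s x * c%:E)%E) ->
    (\esum_(i in D) s (h i) = \int[nu]_y s (G (prefix_of k y)))%E.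
  move=> s0 sM; rewrite (@reindex_esum R _ _ setT D code _ bij).
  rewrite (@ge0_integral_prefix_esum k (fun t => s (G t)))//.
  by apply: eq_esum => t _; rewrite hG sM.
have maxM (x c : R) : 0 <= c -> (maxe (x * c)%:E 0 = maxe x%:E 0 * c%:E)%E.
  by move=> c0; rewrite EFinM !(muleC _ c%:E) maxe_pMr// ?mule0// lee_fin.
rewrite /sum_over [in RHS]integralE; congr (fine (_ - _)).
  rewrite (eq_esum (b := fun i => maxe (h i)%:E 0)); last by move=> i _; rewrite funeposE.
  rewrite (E (fun x => maxe x%:E 0%E))//; last by move=> x; rewrite le_max lexx orbT.
  by apply: eq_integral => y _; rewrite funeposE.
rewrite (eq_esum (b := fun i => maxe (- h i)%:E 0)); last by move=> i _; rewrite funenegE.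
rewrite (E (fun x => maxe (- x)%:E 0%E)).
- by apply: eq_integral => y _; rewrite funenegE.
- by move=> x; rewrite le_max lexx orbT.
- by move=> x c c0; rewrite -mulNr maxM.
Qed.

End PrefixSums.

(** * The law of the norms of the partial quotients *)

Lemma geometric_total_weight (R : realFieldType) (q : nat) :
  (1 < q)%N -> q.-1%:R / q%:R / (1 - q%:R^-1) = 1 :> R.
Proof.
case: q => // q q0; have q1 : q.+1%:R - 1 = q%:R :> R by rewrite -natr1 addrK.
have qn0 : q%:R != 0 :> R by rewrite pnatr_eq0 -lt0n.
have -> : 1 - q.+1%:R^-1 = q%:R / q.+1%:R :> R.
  by rewrite -q1 mulrBl divff ?pnatr_eq0// div1r.
by rewrite divff// mulf_neq0// invr_eq0 pnatr_eq0.
Qed.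

Section FiniteUnion.
Context d (T : measurableType d) (R : realType) (mu : {measure set T -> \bar R}).

Lemma measure_equal_pieces (I : finType) (F : I -> set T) (c : R) :
  (forall i, measurable (F i)) -> (forall i j x, F i x -> F j x -> i = j) ->
  (forall i, mu (F i) = c%:E) ->
  measurable (\bigcup_i F i) /\ mu (\bigcup_i F i) = (#|I|%:R * c)%:E.
Proof.
move=> mF F_disj Fc; split; first by apply: fin_bigcup_measurable => //; exact: finite_finset.
rewrite measure_fin_bigcup//; [|exact: finite_finset|]; last first.
  by move=> i j _ _ [x [ix jx]]; exact: F_disj ix jx.
have -> : [set: I] = [set` enum I].
  by apply/seteqP; split=> // i _ /=; rewrite mem_enum.
rewrite -(@fsbig_seq _ _ _ I (enum I) (fun i => mu (F i)) (enum_uniq _)) big_enum/=.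
rewrite (eq_bigr (fun=> c%:E)); last by move=> i _; rewrite Fc.
by rewrite sumEFin sumr_const mulr_natl.
Qed.
End FiniteUnion.

(** * Balls, spheres and cylinders in a discretely valued field *)

Section Balls.
Variables (R : realType) (Qp : fieldType) (K : fieldExtType Qp).
Variable v : absolute_value R K.
Hypothesis na : nonarch v.
Variable beta : K.
Hypothesis beta_gt1 : 1 < v beta.
Hypothesis value : forall x, x != 0 -> exists z : int, v x = v beta ^ z.
Variables (D : finType) (rep : D -> K).
Hypothesis rep_le1 : forall d, v (rep d) <= 1.
Hypothesis rep_exists : forall x, v x <= 1 -> exists d, v (x - rep d) < 1.
Hypothesis rep_inj : forall d d', v (rep d - rep d') < 1 -> d = d'.
Variable floor : K -> K.
Hypothesis floor_sub : forall x, v (x - floor x) < 1.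
Hypothesis floor_eq : forall x y, v (x - y) < 1 -> floor x = floor y.

Let beta_gt0 : 0 < v beta. Proof. exact: lt_trans beta_gt1. Qed.
Let beta_neq0 : beta != 0. Proof. by rewrite -(absv_gt0 v). Qed.
Let bX_gt0 n : 0 < v beta ^+ n. Proof. exact: exprn_gt0. Qed.
Let bX_ge1 n : 1 <= v beta ^+ n. Proof. by rewrite exprn_ege1// ltW. Qed.
Let bXN_gt0 n : 0 < v beta ^- n. Proof. by rewrite invr_gt0. Qed.
Let bXN_le1 n : v beta ^- n <= 1. Proof. by rewrite invf_le1. Qed.

Definition vball (a : K) (n : nat) : set (borel v) :=
  [set x | v ((x : K) - a) < v beta ^- n].

Lemma vball_measurable a n : measurable (vball a n).
Proof.
apply: sub_sigma_algebra.
have -> : vball a n = [set y : valued v | v (a - (y : K)) < v beta ^- n].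
  by apply/seteqP; split=> x; rewrite /vball /= absvB.
exact: open_absv_ball.
Qed.

(** Disjointness is expressed on centres alone: two ultrametric balls of equal radius meet exactly
    when their centres are closer than that radius. *)
Definition ball_partition (n : nat) (I : finType) (c : I -> K) (A : set (borel v)) :=
  (forall i j, v (c i - c j) < v beta ^- n -> i = j) /\
  (forall x : K, A x <-> exists i, v (x - c i) < v beta ^- n).

Lemma ball_partition1 a n : ball_partition n (fun _ : unit => a) (vball a n).
Proof. by split=> [[] []//|x]; split=> [xa|[]]; [exists tt|]. Qed.

Lemma value_lt1 x : v x < 1 -> v x <= (v beta)^-1.
Proof.
have [->|x0] := eqVneq x 0; first by rewrite absv0 invr_ge0 ltW.
have [z ->] := value x0; rewrite -{1}(expr0z (v beta)) ltr_eXz2l// => z0.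
by rewrite -exprN1 ler_eXz2l//; lia.
Qed.

Lemma value_lt_level x n : v x < v beta ^- n -> v x <= v beta ^- n.+1.
Proof.
move=> h; have : v (x * beta ^+ n) <= (v beta)^-1.
  by apply: value_lt1; rewrite absvM absvX -ltr_pdivlMr// div1r.
rewrite absvM absvX -ler_pdivlMr// => /le_trans; apply.
by rewrite exprS invfM.
Qed.

(** Values being discrete, a difference below level [n] becomes integral after multiplication by
    beta^(n+1); its residue selects the smaller ball. *)
Lemma ball_partition_refine n (I : finType) (c : I -> K) A :
  ball_partition n c A ->
  ball_partition n.+1 (fun i : I * D => c i.1 + beta ^- n.+1 * rep i.2) A.
Proof.
move=> [cinj cA]; have small d : v (beta ^- n.+1 * rep d) < v beta ^- n.
  rewrite absvM absvV absvX; apply: (@le_lt_trans _ _ (v beta ^- n.+1)).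
    by rewrite ler_piMr// ltW.
  by rewrite ltf_pV2 ?posrE// exprS ltr_pMl.
split=> [[i d] [j d'] /= h|x].
  have ij : i = j.
    apply: cinj.
    apply: (@nonarch_ltB _ _ v na _ (c i + beta ^- n.+1 * rep d)).
      by rewrite opprD addNKr absvN.
    apply: (@nonarch_ltB _ _ v na _ (c j + beta ^- n.+1 * rep d')).
      by apply: lt_le_trans h _; rewrite lef_pV2 ?posrE// exprS ler_peMl// ltW.
    by rewrite addrAC subrr add0r.
  rewrite ij in h *; congr (_, _); apply: rep_inj; move: h.
  rewrite opprD addrACA subrr add0r -mulrBr absvM absvV absvX.
  by rewrite gtr_pMr.
rewrite cA; split=> [[i xi]|[[i d] /= xi]].
  have : v ((x - c i) * beta ^+ n.+1) <= 1.
    by rewrite absvM absvX -ler_pdivlMr// div1r value_lt_level.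
  move=> /rep_exists[d hd]; exists (i, d) => /=.
  rewrite opprD addrA -[X in _ < X]div1r ltr_pdivlMr// -absvX -absvM mulrBl.
  by rewrite mulrAC mulVf ?mul1r// expf_neq0.
exists i; rewrite -(subrK (beta ^- n.+1 * rep d) (x - c i)) nonarch_lt//.
rewrite -addrA -opprD; apply: lt_le_trans xi _.
by rewrite lef_pV2 ?posrE// exprS ler_peMl// ltW.
Qed.

Lemma ball_partition_refine_iter n j (I : finType) (c : I -> K) A :
  ball_partition n c A ->
  exists (J : finType) (c' : J -> K), ball_partition (n + j) c' A /\
    #|J| = (#|I| * #|D| ^ j)%N.
Proof.
move=> cA; elim: j => [|j [J [c' [c'A cardJ]]]].
  by exists I, c; rewrite addn0 expn0 muln1.
exists [the finType of (J * D)%type]; eexists; split.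
  rewrite addnS; exact: ball_partition_refine c'A.
by rewrite card_prod cardJ expnSr mulnA.
Qed.

Lemma ball_partition_scale n (I : finType) (c : I -> K) A :
  ball_partition n c A ->
  ball_partition 0 (fun i => beta ^+ n * c i) [set x : borel v | A (beta ^- n * (x : K))].
Proof.
move=> [cinj cA]; rewrite /ball_partition expr0 invr1; split=> [i j|x].
  rewrite -mulrBr absvM absvX mulrC -ltr_pdivlMr// div1r; exact: cinj.
have E i : (v (x - beta ^+ n * c i) < 1) = (v (beta ^- n * x - c i) < v beta ^- n).
  rewrite -[X in _ = (_ < X)]div1r ltr_pdivlMr// -absvX -absvM mulrBl.
  by rewrite mulrAC mulVf ?expf_neq0// mul1r (mulrC (c i)).
by rewrite /= cA; split=> -[i]; rewrite ?E => h; exists i; rewrite ?E.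
Qed.

Definition unit_rep := {d : D | v (rep d) == 1}.

Lemma unit_rep_partition :
  ball_partition 0 (fun d : unit_rep => rep (val d)) [set x : borel v | v (x : K) = 1].
Proof.
rewrite /ball_partition expr0 invr1; split=> [d d' /rep_inj /val_inj //|x].
split=> [/= x1|[d xd] /=].
  have /rep_exists[d xd] : v x <= 1 by rewrite x1.
  have d1 : v (rep d) == 1 by rewrite -x1; apply/eqP/(nonarch_eq na); rewrite x1.
  by exists (Sub d d1).
by rewrite -(eqP (valP d)); apply: (nonarch_eq na); rewrite (eqP (valP d)) absvB.
Qed.

(** Exactly one representative, that of the class of 0, has absolute value below 1. *)
Lemma card_unit_rep : #|{: unit_rep}| = #|D|.-1.
Proof.
have /rep_exists[d0] : v 0 <= 1 by rewrite absv0.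
rewrite sub0r absvN => d0lt.
rewrite card_sig -(cardC1 d0); apply: eq_card => d; rewrite !inE.
apply/eqP/idP => [d1|dd0]; first by apply: contraTneq d0lt => <-; rewrite d1 ltxx.
apply/eqP; rewrite eq_le rep_le1 leNgt; apply: contra dd0 => dlt.
by apply/eqP/rep_inj; rewrite nonarch_lt ?absvN.
Qed.

(** The unit sphere consists of q - 1 unit balls; refining it [i] times and scaling by beta^i
    restores unit radius. The count is the number of partial quotients of this norm. *)
Lemma sphere_partition i : exists (I : finType) (c : I -> K),
  ball_partition 0 c [set x : borel v | v (x : K) = v beta ^+ i] /\
  #|I| = (#|D|.-1 * #|D| ^ i)%N.
Proof.
have [I [c [/ball_partition_scale cA cardI]]] :=
  ball_partition_refine_iter i unit_rep_partition.
exists I; exists (fun j => beta ^+ i * c j); rewrite add0n in cA; split.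
  suff <- : [set x : borel v | v (beta ^- i * (x : K)) = 1] =
            [set x : borel v | v (x : K) = v beta ^+ i] by [].
  apply/seteqP; split=> x /=; rewrite absvM absvV absvX.
    by move=> /(congr1 ( *%R (v beta ^+ i))); rewrite mulVKf ?mulr1// gt_eqF.
  by move=> ->; rewrite mulVf// gt_eqF.
by rewrite cardI card_unit_rep.
Qed.

(** The continued fraction map over an abstract integral part; for [cf_floor] it is convertible to
    [cf_map]. *)
Definition gauss_map (x : K) : K := if x == 0 then 0 else x^-1 - floor x^-1.

Lemma gauss_map_lt1 x : v (gauss_map x) < 1.
Proof. by rewrite /gauss_map; case: ifP => // _; rewrite absv0. Qed.

(** On a sphere inversion scales all distances by one factor, the source of the level shift
    [2 * i.+1] below. *)
Lemma absv_subV (x y : K) : x != 0 -> v x = v y -> v (x^-1 - y^-1) = v (x - y) / v x ^+ 2.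
Proof.
move=> x0 xy; have y0 : y != 0 by rewrite -(absv_gt0 v) -xy absv_gt0.
have -> : x^-1 - y^-1 = (y - x) / (x * y) by field; rewrite x0 y0.
by rewrite absvM absvV absvM -xy absvB expr2.
Qed.

(** A preimage is determined by its partial quotient and its image. The new centres are therefore
    the inverses of [floor (s j) + c k], with [j] running over the unit balls of the sphere of
    radius |beta|^(i+1) and [k] over the balls of [A]. *)
Lemma gauss_preimage_partition n i (I : finType) (c : I -> K) A :
  (forall x : K, A x -> v x < 1) -> ball_partition n c A ->
  exists (J : finType) (c' : J -> K),
    ball_partition (n + 2 * i.+1) c'
      [set x : borel v | v (x : K) = v beta ^- i.+1 /\ A (gauss_map x)] /\
    #|J| = (#|I| * (#|D|.-1 * #|D| ^ i.+1))%N.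
Proof.
move=> A1 [cinj cA]; have [J [s [[sinj sA] cardJ]]] := sphere_partition i.+1.
rewrite expr0 invr1 in sinj sA.
have c1 k : v (c k) < 1 by apply: A1; apply/cA; exists k; rewrite subrr absv0.
have b1 : 1 < v beta ^+ i.+1 by rewrite exprn_egt1.
pose y (jk : J * I) := floor (s jk.1) + c jk.2.
have ys jk : v (y jk - s jk.1) < 1.
  by rewrite /y addrAC nonarch_lt// absvB.
have yabs jk : v (y jk) = v beta ^+ i.+1.
  rewrite -((sA (s jk.1)).2 _); last by exists jk.1; rewrite subrr absv0.
  apply: (nonarch_eq na); rewrite absvB (lt_trans (ys jk))//.
  by rewrite ((sA (s jk.1)).2 _)//; exists jk.1; rewrite subrr absv0.
have y0 jk : y jk != 0 by rewrite -(absv_gt0 v) yabs.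
have lvl : v beta ^- (n + 2 * i.+1) = v beta ^- n / (v beta ^+ i.+1) ^+ 2.
  by rewrite exprD invfM mulnC exprM.
exists [the finType of (J * I)%type]; exists (fun jk => (y jk)^-1).
split; last by rewrite card_prod cardJ mulnC.
split=> [jk jk'|x].
  rewrite absv_subV ?yabs// lvl ltr_pM2r ?invr_gt0 ?exprn_gt0// => h.
  have jj : jk.1 = jk'.1.
    apply: sinj; apply: (@nonarch_ltB _ _ v na _ (y jk)); first by rewrite absvB.
    apply: (@nonarch_ltB _ _ v na _ (y jk')); first exact: lt_le_trans h _.
    exact: ys.
  move: jk jk' jj h {y0} => [j k] [j' k'] /= -> h.
  congr (_, _); apply: cinj; move: h; rewrite /y/=.
  by rewrite opprD addrACA subrr add0r.
split=> [/= [xi Ax]|[jk /= h]].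
  have x0 : x != 0 by rewrite -(absv_gt0 v) xi.
  move: Ax; rewrite /gauss_map (negbTE x0) => /cA[k hk].
  have /sA[j hj] : v x^-1 = v beta ^+ i.+1 by rewrite absvV xi invrK.
  exists (j, k); rewrite (floor_eq hj) in hk.
  rewrite -[x]invrK absv_subV ?invr_eq0 ?yabs ?absvV ?xi ?invrK//.
  by rewrite lvl ltr_pM2r ?invr_gt0 ?exprn_gt0// /y opprD addrA.
have xi : v x = v beta ^- i.+1.
  rewrite -(yabs jk) -absvV; apply: (nonarch_eq na); rewrite absvB.
  apply: lt_le_trans h _; rewrite absvV yabs.
  by rewrite lef_pV2 ?posrE// ler_weXn2l ?(ltW beta_gt1)//; lia.
have x0 : x != 0 by rewrite -(absv_gt0 v) xi.
split=> //; rewrite /gauss_map (negbTE x0).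
have {}h : v (x^-1 - y jk) < v beta ^- n.
  move: h; rewrite -{1}[x]invrK absv_subV ?invr_eq0 ?yabs ?absvV ?xi ?invrK//.
  by rewrite lvl ltr_pM2r ?invr_gt0 ?exprn_gt0.
have /floor_eq -> : v (x^-1 - s jk.1) < 1.
  by apply: (@nonarch_ltB _ _ v na _ (y jk)) => //; exact: lt_le_trans h _.
by apply/cA; exists jk.2; rewrite -addrA -opprD.
Qed.

Lemma level_inj i j : v beta ^- i.+1 = v beta ^- j.+1 -> i = j.
Proof.
by move=> /invr_inj /(ieexprIn beta_gt0 (negbT (gt_eqF beta_gt1))) [].
Qed.

Variable mu : {measure set (borel v) -> \bar R}.
Hypothesis mu_haar : haar mu.
Hypothesis mu_ball : mu (unit_ball v) = 1%E.

Let q := #|D|.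

Lemma card_residues_gt1 : (1 < q)%N.
Proof.
have /rep_exists[d0 h0] : v 0 <= 1 by rewrite absv0.
have /rep_exists[d1 h1] : v 1 <= 1 by rewrite absv1.
apply/card_gt1P; exists d0, d1; split=> //; apply/eqP => d01.
have : v (1 - 0) < 1 by apply: (nonarch_ltB na h1); rewrite -d01 absvB.
by rewrite subr0 absv1 ltxx.
Qed.

Let q_gt0 : 0 < q%:R :> R.
Proof. by rewrite ltr0n ltnW// card_residues_gt1. Qed.

Lemma vball_translate a n : mu (vball a n) = mu (vball 0 n).
Proof.
have [tr _ _] := mu_haar; rewrite -(tr a _ (vball_measurable 0 n)); congr (mu _).
apply/seteqP; split=> [x xa|x [y ya <-]]; rewrite /vball/=.
  by exists ((x : K) - a); rewrite /vball/= ?subr0// addrC subrK.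
by move: ya; rewrite /vball/= subr0 addrAC subrr add0r.
Qed.

Lemma vball_unit : vball 0 0 = unit_ball v.
Proof. by apply/seteqP; split=> x; rewrite /vball /unit_ball/= subr0 expr0 invr1. Qed.

(** The measure [t] of a ball is left as a parameter because this count is used to compute it. *)
Lemma partition_pieces n (I : finType) (c : I -> K) A t :
  ball_partition n c A -> mu (vball 0 n) = t%:E ->
  measurable A /\ mu A = (#|I|%:R * t)%:E.
Proof.
move=> [cinj cA] ht.
have -> : A = \bigcup_i vball (c i) n.
  by apply/seteqP; split=> x; [move=> /cA[i xi]; exists i|move=> [i _ xi]; apply/cA; exists i].
apply: measure_equal_pieces => [i|i j x xi xj|i]; first exact: vball_measurable.
  apply: cinj; apply: (@nonarch_ltB _ _ v na _ x) => //.
  by rewrite absvB.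
by rewrite vball_translate.
Qed.

Lemma vball_measure a n : mu (vball a n) = (q%:R ^- n)%:E.
Proof.
rewrite vball_translate; elim: n => [|n IH].
  by rewrite vball_unit mu_ball expr0 invr1.
(* Finiteness lets the equation q t = q^(-n), from the splitting into q translates, be solved in the
   reals. *)
have fin : mu (vball 0 n.+1) \is a fin_num.
  rewrite ge0_fin_numE//; apply: (@le_lt_trans _ _ (mu (vball 0 n))); last by rewrite IH ltry.
  apply: le_measure; rewrite ?inE; [exact: vball_measurable..|].
  move=> x; rewrite /vball/= => /lt_le_trans; apply.
  by rewrite lef_pV2 ?posrE// exprS ler_peMl// ltW.
have := partition_pieces (ball_partition_refine (ball_partition1 0 n)) (esym (fineK fin)).
move=> [_]; rewrite IH card_prod card_unit mul1n => -[E].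
rewrite -(fineK fin); congr (_%:E); rewrite exprS invfM E mulKf// gt_eqF//.
Qed.

Lemma partition_measure n (I : finType) (c : I -> K) A :
  ball_partition n c A -> measurable A /\ mu A = (#|I|%:R / q%:R ^+ n)%:E.
Proof. by move=> cA; exact: partition_pieces cA (vball_measure 0 n). Qed.

(* [s] lists the exponents of the norms of the first partial quotients, minus one *)
Fixpoint norm_cylinder (s : seq nat) : set (borel v) :=
  if s is i :: s' then
    [set x | v (x : K) = v beta ^- i.+1 /\ norm_cylinder s' (gauss_map x)]
  else unit_ball v.

(** Here (q-1) q^(i+1) partial quotients share the norm |beta|^(i+1), each contributing a factor
    q^(-2(i+1)). *)
Definition norm_weight (i : nat) : R := q.-1%:R / q%:R ^+ i.+1.

Lemma norm_cylinder_lt1 s (x : K) : norm_cylinder s x -> v x < 1.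
Proof. by case: s => [|i s] //= [-> _]; rewrite invf_lt1// exprn_egt1. Qed.

Lemma norm_cylinder_partition s : exists n (I : finType) (c : I -> K),
  ball_partition n c (norm_cylinder s) /\
  #|I|%:R / q%:R ^+ n = \prod_(i <- s) norm_weight i.
Proof.
elim: s => [|i s [n [I [c [cA E]]]]].
  exists 0%N, unit, (fun=> 0); rewrite /= -vball_unit; split; first exact: ball_partition1.
  by rewrite big_nil card_unit expr0 divr1.
have [J [c' [c'A cardJ]]] := gauss_preimage_partition i (@norm_cylinder_lt1 s) cA.
exists (n + 2 * i.+1)%N, J, c'; split=> //.
rewrite big_cons -E cardJ !natrM natrX exprD mulnC exprM /norm_weight -/q; field.
by rewrite !expf_neq0// gt_eqF.
Qed.

Lemma norm_cylinder_measure s : measurable (norm_cylinder s) /\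
  mu (norm_cylinder s) = (\prod_(i <- s) norm_weight i)%:E.
Proof.
have [n [I [c [cA <-]]]] := norm_cylinder_partition s.
exact: partition_measure cA.
Qed.

(** Cylinders are built from the first exponent on; following an expansion until it stops requires
    adding one at the end. *)
Lemma norm_cylinder_rcons s i (x : K) : norm_cylinder (rcons s i) x <->
  norm_cylinder s x /\ v (iter (size s) gauss_map x) = v beta ^- i.+1.
Proof.
elim: s x => [|j s IH] x /=.
  split=> [[xi _]|[_ xi]]; split=> //; last exact: gauss_map_lt1.
  by rewrite /unit_ball/= xi invf_lt1// exprn_egt1.
by rewrite IH -iterSr iterS; tauto.
Qed.

Lemma norm_weight_cvg : series norm_weight @ \oo --> (1 : R).
Proof.
have q1 : 1 < q%:R :> R by rewrite ltr1n card_residues_gt1.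
have := @cvg_geometric_series R (q.-1%:R / q%:R) (q%:R^-1).
rewrite ger0_norm ?invr_ge0 ?ltW// invf_lt1// q1 => /(_ isT).
have -> : q.-1%:R / q%:R / (1 - q%:R^-1) = 1 :> R.
  exact: geometric_total_weight card_residues_gt1.
suff -> : geometric (q.-1%:R / q%:R) q%:R^-1 = norm_weight by [].
by apply/funext => n; rewrite /norm_weight/= exprS invfM exprVn mulrA.
Qed.

(** The weights sum to 1, so the one-step extensions already have the full measure of the cylinder;
    what is left are the points whose expansion stops right after [s]. *)
Lemma norm_cylinder_terminating s :
  mu.-negligible (norm_cylinder s `\` \bigcup_i norm_cylinder (rcons s i)).
Proof.
have [mC muC] := norm_cylinder_measure s.
have mU : measurable (\bigcup_i norm_cylinder (rcons s i)).
  by apply: bigcupT_measurable => i; case: (norm_cylinder_measure (rcons s i)).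
have sub : \bigcup_i norm_cylinder (rcons s i) `<=` norm_cylinder s.
  by move=> x [i _ /norm_cylinder_rcons[]].
apply/negligibleP; first exact: measurableD.
have Coo : (mu (norm_cylinder s) < +oo)%E by rewrite muC ltry.
suff muU : mu (\bigcup_i norm_cylinder (rcons s i)) = mu (norm_cylinder s).
  transitivity (mu (norm_cylinder s) - mu (norm_cylinder s `&`
      \bigcup_i norm_cylinder (rcons s i)))%E; first exact: measureD.
  by rewrite (setIidr sub) muU muC subee.
set P := \prod_(i <- s) norm_weight i in muC *.
transitivity (\sum_(0 <= i <oo | i \in [set: nat]) mu (norm_cylinder (rcons s i)))%E.
  apply: measure_bigcup => [i _|i j _ _ [x []]].
    by case: (norm_cylinder_measure (rcons s i)).
  by move=> /norm_cylinder_rcons[_ xi] /norm_cylinder_rcons[_]; rewrite xi => /level_inj.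
rewrite muC (eq_eseriesr (g := fun i => (P * norm_weight i)%:E)); last first.
  by move=> i _; have [_ ->] := norm_cylinder_measure (rcons s i); rewrite big_rcons.
apply/cvg_lim => //; apply: cvg_EFin; first by apply: nearW => n; rewrite sumEFin.
have -> : fine \o (fun n => \sum_(0 <= i < n | i \in [set: nat]) (P * norm_weight i)%:E)%E =
    (fun n => P * series norm_weight n).
  apply/funext => n /=; rewrite sumEFin /= /series/= mulr_sumr.
  by apply: eq_bigl => i; rewrite in_setT.
by rewrite -[X in _ --> X]mulr1; apply: cvgM norm_weight_cvg; exact: cvg_cst.
Qed.

(** * Coding of points by the exponents of their partial quotients *)

Definition norm_level (x : K) : nat := xget 0%N [set i | v x = v beta ^- i.+1].

Lemma norm_levelP x : x != 0 -> v x < 1 -> v x = v beta ^- (norm_level x).+1.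
Proof.
move=> x0 x1; rewrite /norm_level; case: xgetP => [i _ //|] /=.
have [z zE] := value x0; move: x1; rewrite zE -{1}(expr0z (v beta)) ltr_eXz2l// => z0.
have [i iE] : exists i : nat, z = - (i.+1%:Z) by exists (absz z).-1; lia.
by move=> /(_ i); rewrite iE -exprnN => /(_ erefl).
Qed.

Lemma norm_level_eq x i : v x = v beta ^- i.+1 -> norm_level x = i.
Proof.
move=> xi; apply: level_inj; rewrite -norm_levelP// ?xi ?invf_lt1 ?exprn_egt1//.
by rewrite -(absv_gt0 v) xi.
Qed.

Definition nonterminating : set (borel v) :=
  [set x | v (x : K) < 1 /\ forall n, iter n gauss_map (x : K) != 0].

Lemma nonterminating_gauss (x : K) : nonterminating x -> nonterminating (gauss_map x).
Proof.
by move=> [_ xn]; split=> [|n]; [exact: gauss_map_lt1|rewrite -iterSr].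
Qed.

Lemma nonterminating_iter n (x : K) : nonterminating x -> nonterminating (iter n gauss_map x).
Proof. by elim: n => //= n IH /IH; exact: nonterminating_gauss. Qed.

Lemma nonterminating_cylinder s (x : K) : nonterminating x ->
  norm_cylinder s x <->
  forall j, (j < size s)%N -> norm_level (iter j gauss_map x) = nth 0%N s j.
Proof.
elim: s x => [|i s IH] x gx /=; first by split=> // _; case: gx.
have [x1 /(_ 0%N) /= x0] := gx.
rewrite (IH _ (nonterminating_gauss gx)); split=> [[xi H] [|j] /=|H].
- by move=> _; exact: norm_level_eq.
- by rewrite ltnS -iterS iterSr; exact: H.
- split; first by rewrite norm_levelP// (H 0%N).
  by move=> j js; have := H j.+1 js; rewrite iterSr.
Qed.

(** Measurability comes from this countable description by cylinders, whose measurability is known,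
    instead of from that of the map. *)
Lemma nonterminatingE : nonterminating =
  \bigcap_n \bigcup_(s : seq nat) (if size s == n then norm_cylinder s else set0).
Proof.
apply/seteqP; split=> [x gx n _|x H].
  exists [seq norm_level (iter j gauss_map (x : K)) | j <- iota 0 n] => //=.
  rewrite size_map size_iota eqxx; apply/(nonterminating_cylinder _ gx) => j.
  by rewrite size_map size_iota => jn; rewrite (nth_map 0%N) ?size_iota// nth_iota.
split=> [|n].
  have [s _] := H 0%N I; case: ifP => // _ /norm_cylinder_lt1; exact.
have [s _] := H n.+1 I; case: ifP => // /eqP; case/lastP: s => // s i.
rewrite size_rcons => -[<-] /norm_cylinder_rcons[_ E].
by rewrite -(absv_gt0 v) E.
Qed.

Lemma nonterminating_measurable : measurable nonterminating.
Proof.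
rewrite nonterminatingE; apply: bigcapT_measurable => n.
apply: countable_bigcupT_measurable => // s.
by case: ifP => // _; case: (norm_cylinder_measure s).
Qed.

Lemma nonterminating_ae : mu.-negligible (unit_ball v `\` nonterminating).
Proof.
pose F n := if (unpickle n : option (seq nat)) is Some s
  then norm_cylinder s `\` \bigcup_i norm_cylinder (rcons s i) else set0.
apply: (@negligibleS _ _ _ _ (\bigcup_n F n)); last first.
  apply: negligible_bigcup => n; rewrite /F; case: unpickle => [s|]; last exact: negligible_set0.
  exact: norm_cylinder_terminating.
move=> x [x1 xg].
have [n xn] : exists n, iter n gauss_map (x : K) == 0.
  apply: contrapT => /forallNP H; apply: xg; split=> // n.
  by apply/negP; exact: H.
(* At the first vanishing iterate [m], the point has a cylinder of length [m] and belongs to no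
   extension of it. *)
have [m xm mmin] := ex_minnP (ex_intro (fun n => iter n gauss_map (x : K) == 0) n xn).
have [s [sm xs]] : exists s, size s = m /\ norm_cylinder s x.
  have : forall j, (j < m)%N -> iter j gauss_map (x : K) != 0.
    by move=> j jm; apply: contraTN jm => /mmin; rewrite leqNgt.
  move: (m) => k; elim: k => [|k IH] H; first by exists [::].
  have [s [sk xs]] := IH (fun j jk => H j (ltnW jk)).
  exists (rcons s (norm_level (iter k gauss_map (x : K)))); rewrite size_rcons sk; split=> //.
  apply/norm_cylinder_rcons; split=> //; rewrite sk; apply: norm_levelP; first exact: H.
  by case: (k) => // k'; exact: gauss_map_lt1.
exists (pickle s) => //; rewrite /F pickleK; split=> // -[i _ /norm_cylinder_rcons[_]].
rewrite sm (eqP xm) absv0 => /eqP; rewrite eq_sym gt_eqF//.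
Qed.

(* Terminating expansions form a null set and get the junk code 0, so that no digit is
   reserved for them. *)
Definition norm_code (x : K) : nat -> nat :=
  if x \in nonterminating then fun n => norm_level (iter n gauss_map x) else fun=> 0%N.

(** The second set accounts for the default code: the zero sequence begins with [s] only if [s]
    consists of zeros. *)
Lemma norm_code_preimage s : (norm_code : borel v -> _) @^-1` prefix_set s =
  (nonterminating `&` norm_cylinder s) `|`
  (if all (pred1 0%N) s then ~` nonterminating else set0).
Proof.
apply/seteqP; split=> x; rewrite /= /prefix_set/= /norm_code.
  case: ifPn => [/set_mem gx H|/negP xN H].
    by left; split=> //; apply/(nonterminating_cylinder _ gx).
  right; rewrite ifT; first by move=> gx; apply: xN; exact/mem_set.
  by apply/(all_nthP 0%N) => j /H /= <-.
case=> [[gx /(nonterminating_cylinder _ gx) H]|]; first by rewrite mem_set.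
case: ifP => // /(all_nthP 0%N) s0 xN; rewrite memNset// => j /s0 /= /eqP ->//.
Qed.

Lemma norm_code_measurable s :
  measurable ((norm_code : borel v -> _) @^-1` prefix_set s).
Proof.
rewrite norm_code_preimage; apply: measurableU.
  apply: measurableI; [exact: nonterminating_measurable|by case: (norm_cylinder_measure s)].
by case: ifP => // _; apply: measurableC; exact: nonterminating_measurable.
Qed.

Lemma measure_nonterminating (A : set (borel v)) : measurable A -> A `<=` unit_ball v ->
  mu A = mu (A `&` nonterminating).
Proof.
move=> mA AB; have mG := nonterminating_measurable.
rewrite (measureDI _ mA mG) [X in (X + _)%E](_ : _ = 0%E) ?add0e//.
apply/negligibleP; first exact: measurableD.
by apply: negligibleS nonterminating_ae; exact: setSD.
Qed.

Lemma unit_ball_measurable : measurable (unit_ball v).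
Proof. by rewrite -vball_unit; exact: vball_measurable. Qed.

Lemma norm_code_measure s :
  mu (((norm_code : borel v -> _) @^-1` prefix_set s) `&` unit_ball v) =
  (\prod_(i <- s) norm_weight i)%:E.
Proof.
have [mC <-] := norm_cylinder_measure s.
have mP := norm_code_measurable s; have mB := unit_ball_measurable.
rewrite measure_nonterminating//; last exact: measurableI.
rewrite [RHS]measure_nonterminating//; last by move=> x /norm_cylinder_lt1.
congr (mu _); rewrite norm_code_preimage; apply/seteqP; split=> x /=.
  by case=> -[[[gx xC]|]] //; case: ifP.
by move=> [xC gx]; split=> //; split; [left|case: gx].
Qed.

(** The integral part differs from the inverse by less than 1, while the inverse has norm above 1,
    so both have the same norm. The real exponent matches the powers of [p] in the final sum. *)
Lemma nonterminating_partial_quotient (x : K) n : nonterminating x ->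
  v (floor (iter n gauss_map x)^-1) = v beta `^ (norm_code x n).+1%:R.
Proof.
move=> gx; rewrite /norm_code mem_set//.
have [y1 /(_ 0%N) /= y0] := nonterminating_iter n gx.
set y := iter n gauss_map x in y1 y0 *.
rewrite powR_mulrn ?absv_ge0//.
have yE : v y^-1 = v beta ^+ (norm_level y).+1 by rewrite absvV norm_levelP// invrK.
rewrite -yE; apply: (nonarch_eq na); apply: lt_trans (floor_sub _) _.
by rewrite yE exprn_egt1.
Qed.

Lemma norm_code_measurable_fun : measurable_fun setT (norm_code : borel v -> seq_space).
Proof.
apply: (@measurability _ _ (borel v) seq_space setT norm_code prefix_sets)
  => // _ [_ [->|[s ->]] <-].
  by rewrite preimage_set0 setI0.
by rewrite setTI; exact: norm_code_measurable.
Qed.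

(** [nu] is the law of the code under [mu] on the ball. The second clause brings exceptional sets
    back to K, the third transfers integrals. *)
Lemma norm_code_law : exists nu : probability seq_space R,
  [/\ forall s, nu (prefix_set s) = (\prod_(i <- s) norm_weight i)%:E,
      forall N, measurable N -> nu N = 0%E ->
        mu.-negligible ((norm_code : borel v -> seq_space) @^-1` N `&` unit_ball v) &
      forall F : seq_space -> \bar R, measurable_fun setT F -> (forall y, 0 <= F y)%E ->
        (\int[nu]_y F y = \int[mu]_(x in nonterminating) F (norm_code x))%E].
Proof.
have mB := unit_ball_measurable.
have B1 : mrestr mu mB setT = 1%E by rewrite /mrestr setTI.
pose P : probability (borel v) R :=
  HB.pack (mrestr mu mB) (Measure_isProbability.Build _ _ _ (mrestr mu mB) B1).
pose X : {mfun borel v >-> seq_space} :=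
  HB.pack (norm_code : borel v -> seq_space)
    (isMeasurableFun.Build _ _ _ _ (norm_code : borel v -> seq_space) norm_code_measurable_fun).
exists (distribution P X); split.
- exact: norm_code_measure.
- move=> N mN N0; apply/negligibleP => //; apply: measurableI => //.
  by rewrite -[X in measurable X]setTI; exact: norm_code_measurable_fun.
- move=> F mF F0; have mFc : measurable_fun setT (fun x : borel v => F (norm_code x)).
    by apply: measurableT_comp mF _; exact: norm_code_measurable_fun.
  transitivity (\int[P]_x F (norm_code x))%E.
    by apply: (ge0_integral_pushforward norm_code_measurable_fun P (D := setT)).
  rewrite (@ge0_negligible_integral _ _ _ P setT (~` nonterminating))//.
  + rewrite setTD setCK; apply: eq_measure_integral => A mA AG.
    have E : A `&` unit_ball v = A by apply/setIidl => x /AG [].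
    by first [exact: (congr1 mu E)|exact: (esym (congr1 mu E))].
  + by apply: measurableC; exact: nonterminating_measurable.
  + transitivity (mu (~` nonterminating `&` unit_ball v)) => //.
    rewrite setIC; apply/negligibleP; last exact: nonterminating_ae.
    by apply: measurableI => //; apply: measurableC; exact: nonterminating_measurable.
Qed.

End Balls.

Lemma prod_geometric_weight (R : realFieldType) (q k : nat) (t : k.-tuple nat) :
  \prod_(i <- t) (q.-1%:R / q%:R ^+ i.+1) =
  ((q - 1) ^ k)%N%:R / (q ^ \sum_(j < k) (tnth t j).+1)%N%:R :> R.
Proof.
rewrite big_tuple prodf_div prodr_const card_ord subn1 !natrX; congr (_ / _).
exact: prodrXr.
Qed.

Unset Implicit Arguments.

Theorem proposition21 (R : realType) (p : nat) (p_prime : prime p)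
  (Qp : fieldType) (vp : absolute_value R Qp)
  (Qp_padic : padic_completion p vp)
  (K : fieldExtType Qp) (v : absolute_value R K)
  (v_ext : forall x : Qp, v x%:A = vp x)
  (m e f : nat) (K_deg : \dim {:K} = m) (m_ef : m = (e * f)%N)
  (K_ram : ramification_index v {:K}%AS e)
  (K_res : residue_degree v {:K}%AS f)
  (L : {subfield K}) (L_deg : \dim L = f) (L_unram : unramified v L)
  (gamma : K) (gamma_root : (p ^ f - 1)%N.-primitive_root gamma)
  (L_gamma : <<1; gamma>>%VS = L)
  (beta : K) (K_beta : <<L; beta>>%VS = fullv)
  (beta_abs : v beta = p%:R `^ (e%:R^-1))
  (mu : {measure set (borel v) -> \bar R}) (mu_haar : haar mu)
  (mu_ball : mu (unit_ball v) = 1%E)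
  (k : nat) (k_gt0 : (0 < k)%N) (H : ('I_k -> {nonneg R}) -> R) :
  let c n alpha := partial_quotient p vp e f gamma beta n alpha in
  (\int[mu]_(alpha in unit_ball v)
     (`|H (fun i : 'I_k => absv_nng v (c i.+1 alpha))| ^+ 2)%:E < +oo)%E ->
  forall a : nat -> nat, L2_good_universal R a ->
  (forall theta : R, irrational theta ->
     uniformly_distributed_mod1 (fun n => (a n)%:R * theta)) ->
  let term (i : {ffun 'I_k -> nat}) : R :=
    H (fun j => NngNum (powR_ge0 p%:R ((i j)%:R / e%:R)))
    * ((p ^ f - 1) ^ k)%N%:R / (p ^ (f * \sum_(j < k) i j))%N%:R in
  let Npos := [set i : {ffun 'I_k -> nat} | forall j, (0 < i j)%N] in
  summable Npos (EFin \o term) /\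
  {ae mu, forall alpha, unit_ball v alpha ->
     (fun n : nat => n%:R^-1 * \sum_(1 <= j < n.+1)
        H (fun i : 'I_k => absv_nng v (c (a j + i)%N alpha))) @ \oo
     --> sum_over Npos term}.
Proof.
move=> c Hint a a_good _ term Npos; subst m.
have na := ext_nonarch p_prime Qp_padic v_ext.
have b1 := beta_gt1 p_prime m_ef beta_abs.
have value := ext_value p_prime Qp_padic v_ext m_ef gamma_root beta_abs.
have rep_le := residue_rep_le1 p_prime Qp_padic v_ext gamma_root.
have rep_ex := residue_rep_exists p_prime Qp_padic v_ext m_ef gamma_root beta_abs.
have rep_inj := residue_rep_inj p_prime Qp_padic v_ext m_ef gamma_root.
have fl_sub := cf_floor_sub_lt1 p_prime Qp_padic v_ext m_ef gamma_root beta_abs.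
have fl_eq := cf_floor_eq p_prime Qp_padic v_ext m_ef gamma_root beta_abs.
set fl := cf_floor p vp e f gamma beta in fl_sub fl_eq.
have [nu [nu_prefix nu_null nu_int]] :=
  norm_code_law na b1 value rep_le rep_ex rep_inj fl_sub fl_eq mu_haar mu_ball.
have term_null := nonterminating_ae na b1 value rep_le rep_ex rep_inj fl_sub fl_eq mu_haar mu_ball.
(* Tuples hold exponents minus one, hence the successor. *)
pose G (t : k.-tuple nat) : R :=
  H (fun j => NngNum (powR_ge0 p%:R ((tnth t j).+1%:R / e%:R))).
pose code := norm_code v beta fl.
(* Used twice: with n = 0 for the integrability hypothesis, and with n = a_j - 1 for the
   averages. *)
have HG (x : K) n (s : nat -> nat) : @nonterminating _ _ _ v fl x ->
    (forall i : 'I_k, s i = (n + i).+1) ->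
    H (fun i : 'I_k => absv_nng v (c (s i) x)) = G (prefix_of k (seq_shift n (code x))).
  move=> gx sE; congr H; apply/funext => i; apply/val_inj => /=.
  rewrite tnth_mktuple sE /c /partial_quotient /=.
  rewrite (nonterminating_partial_quotient na b1 value rep_ex fl_sub _ gx).
  by rewrite beta_abs -powRrM [X in _ `^ X]mulrC.
have mg : measurable_fun setT (fun y : seq_space => G (prefix_of k y)).
  exact: prefix_fun_measurable.
have G2 : (\int[nu]_y (G (prefix_of k y) ^+ 2)%:E < +oo)%E.
  rewrite nu_int; last 2 first.
  - by apply/measurable_EFinP; exact: measurable_funX.
  - by move=> y; rewrite lee_fin sqr_ge0.
  (* The hypothesis integrates over the whole ball; on nonterminating points its integrand is the
     coded one. *)
  apply: le_lt_trans Hint; apply: integral_mono_patch => [x _|x _|x].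
  - by rewrite lee_fin sqr_ge0.
  - by rewrite lee_fin sqr_ge0.
  rewrite /patch; case: ifPn => [/set_mem gx|_]; last first.
    by case: ifP => // _; rewrite lee_fin sqr_ge0.
  rewrite mem_set; last by case: gx.
  rewrite (HG x 0%N (fun i => i.+1))//.
  by rewrite lee_fin -normrX ler_norm.
have ig : nu.-integrable setT (fun y => (G (prefix_of k y))%:E).
  have fin : nu [set: seq_space] \is a fin_num by rewrite probability_setT.
  have g2 : (fun y : seq_space => G (prefix_of k y)) \in Lfun nu 2%:E by exact: Lfun2_of_sqr.
  exact: (Lfun1_integrable _ _).1 (Lfun_subset12 fin g2).
have [summ sumE] : summable Npos (EFin \o term) /\
    sum_over Npos term = fine (\int[nu]_y (G (prefix_of k y))%:E).
  apply: (sum_over_prefix nu_prefix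
    (code := fun t : k.-tuple nat => [ffun j => (tnth t j).+1])) => //.
  - split.
    + by move=> t _ j; rewrite ffunE.
    + move=> t t' _ _ /ffunP tt'; apply: eq_from_tnth => j.
      by have := tt' j; rewrite !ffunE => -[].
    + move=> i iN; exists [tuple (i j).-1 | j < k] => //; apply/ffunP => j.
      by rewrite ffunE tnth_mktuple prednK// iN.
  - move=> t; rewrite /term /G -mulrA; congr (H _ * _).
      by apply/funext => j; apply/val_inj; rewrite /= ffunE.
    (* The abstract residue cardinality of the weights is now evaluated as p^f. *)
    rewrite (prod_geometric_weight R #|{ffun 'I_f -> 'I_p}| t).
    rewrite card_ffun !card_ord -expnM; congr (_ / (p ^ (f * _))%N%:R).
    by apply: eq_bigr => j _; rewrite ffunE.
split=> //; rewrite sumE.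
have [N [mN N0 subN]] := seq_average_limit nu_prefix (G := G) a_good G2.
(* The exceptional set joins the points whose code is exceptional for the shift and the terminating
   points. *)
have [M [mM M0 subM]] : mu.-negligible
    ((code : borel v -> seq_space) @^-1` N `&` unit_ball v `|` (unit_ball v `\` nonterminating fl)).
  by apply: negligibleU => //; exact: nu_null.
exists M; split=> // x xN; apply: subM.
have xB : unit_ball v x by apply: contrapT => nB; apply: xN.
have [gx|gx] := pselect (@nonterminating _ _ _ v fl x); last by right.
left; split=> //; apply: subN => /= ylim; apply: xN => _.
suff -> : (fun n : nat => n%:R^-1 * \sum_(1 <= j < n.+1)
        H (fun i : 'I_k => absv_nng v (c (a j + i)%N x))) =
      (fun n : nat => n%:R^-1 * \sum_(1 <= j < n.+1)
        G (prefix_of k (seq_shift (a j - 1) (code x)))) by [].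
  (* Positivity of [a j] for j >= 1 gives a_j + i = ((a_j - 1) + i) + 1 despite truncated
     subtraction. *)
  apply/funext => n; congr (_ * _); apply: eq_big_nat => j /andP[j1 _].
  apply: HG => // i; have := a_good.1.1 j j1; lia.
Qed.
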